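(* Let $\mathscr{K}$ and $\mathscr{T}$ be Hilbert spaces, let $K$ be a non-negative self-adjoint operator on $\mathscr{K}$ with $\ker K=\{0\}$, and let $T$ be a self-adjoint operator on $\mathscr{T}$ bounded from below. On $\mathscr{H}=\mathscr{F}_{\mathrm f}(\mathscr{K})\otimes\mathscr{T}$ let $$H_0=d\Gamma_{\mathrm f}(K)\otimes I+I\otimes T,\qquad H=H_0+H_{\mathrm I},$$ where $H_{\mathrm I}$ is a symmetric operator on $\mathscr{H}$. Assume: (A.1) $H$ is self-adjoint on $\mathscr{D}(H)=\mathscr{D}(H_0)\cap\mathscr{D}(H_{\mathrm I})$ and bounded from below. (A.2) For all $h\in\mathscr{D}(K)$ the weak commutators $[H_{\mathrm I},B(h)\otimes I]^0_{\mathscr{D}(H)}$ and $[H_{\mathrm I},B^*(h)\otimes I]^0_{\mathscr{D}(H)}$ exist. In addition, for any sequence $\{h_n\}_{n=1}^\infty$ in $\mathscr{D}(K)$ such that $\|h_n\|=1$ for all $n\ge 1$ and $h_n\to 0$ weakly, it holds for all $\Psi\in\mathscr{D}(H)$ that $$\lim_{n\to\infty}\left\|[H_{\mathrm I},B(h_n)\otimes I]^0_{\mathscr{D}(H)}\Psi\right\|=0,\qquad \lim_{n\to\infty}\left\|[H_{\mathrm I},B^*(h_n)\otimes I]^0_{\mathscr{D}(H)}\Psi\right\|=0 .$$ Then $$\overline{\{E_0(H)+\lambda \;:\; \lambda\in\sigma_{\mathrm{ess}}(K)\setminus\{0\}\}}\subset\sigma_{\mathrm{ess}}(H),$$ where $E_0(H)=\inf\sigma(H)$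 and $\overline{J}$ denotes the closure of $J\subset\mathbf{R}$.
   Context: $\mathscr{D}(X)$ is the domain of an operator $X$; $\sigma(X)$ and $\sigma_{\mathrm{ess}}(X)$ are the spectrum and essential spectrum of a self-adjoint operator $X$. Inner products are antilinear in the first and linear in the second argument. Fermion Fock space: for a Hilbert space $\mathscr{X}$, $\mathscr{F}_{\mathrm f}(\mathscr{X})=\bigoplus_{n=0}^\infty(\otimes_a^n\mathscr{X})$, where $\otimes_a^n\mathscr{X}$ is the $n$-fold antisymmetric tensor product and $\otimes_a^0\mathscr{X}=\mathbf{C}$; $\Omega_{\mathrm f}=\{1,0,0,\dots\}$ is the Fock vacuum. $B(f)$ and $B^*(g)$, $f,g\in\mathscr{X}$, are the fermionic annihilation and creation operators ($B^*(f)$ is the adjoint of $B(f)$, and $B(f)\Omega_{\mathrm f}=0$). They are bounded with $\|B(f)\|=\|f\|=\|B^*(f)\|$ and satisfy $\{B(f),B^*(g)\}=(f,g)$, $\{B(f),B(g)\}=\{B^*(f),B^*(g)\}=0$, with $\{X,Y\}=XY+YX$. The second quantization $d\Gamma_{\mathrm f}(X)$ of a self-adjoint operator $X$ on $\mathscr{X}$ bounded from below is the self-adjoint operator on $\mathscr{F}_{\mathrm f}(\mathscr{X})$ with $d\Gamma_{\mathrm f}(X)\Omega_{\mathrm f}=0$ and $d\Gamma_{\mathrm f}(X)B^*(f_1)\cdots B^*(f_n)\Omega_{\mathrm f}=\sum_{j=1}^n B^*(f_1)\cdots B^*(Xf_j)\cdots B^*(f_n)\Omega_{\mathrm f}$ for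 $f_j\in\mathscr{D}(X)$. $H_0$ is self-adjoint on $\mathscr{D}(H_0)=\mathscr{D}(d\Gamma_{\mathrm f}(K)\otimes I)\cap\mathscr{D}(I\otimes T)$ and bounded from below. Weak commutator: let $X,Y$ be densely defined linear operators on a Hilbert space. If there exist a linear operator $Z$ and a dense subspace $\mathscr{M}\subset\mathscr{D}(Z)\cap\mathscr{D}(X)\cap\mathscr{D}(X^* )\cap\mathscr{D}(Y)\cap\mathscr{D}(Y^* )$ such that $(X^*\Phi,Y\Psi)-(Y^*\Phi,X\Psi)=(\Phi,Z\Psi)$ for all $\Phi,\Psi\in\mathscr{M}$, then the restriction of $Z$ to $\mathscr{M}$ is called the weak commutator of $X$ and $Y$ on $\mathscr{M}$, denoted $[X,Y]^0_{\mathscr{M}}$; one then says that $[X,Y]^0_{\mathscr{M}}$ exists. *)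

(* Defs.v *)
From HB Require Import structures.
From mathcomp Require Import all_boot all_order all_algebra all_fingroup.
From mathcomp Require Import complex.
From mathcomp Require Import boolp classical_sets functions reals topology.
From mathcomp Require Import normedtype sequences.

Set Implicit Arguments.
Unset Strict Implicit.
Unset Printing Implicit Defensive.

Import Order.TTheory GRing.Theory Num.Theory.
Import numFieldNormedType.Exports.

Local Open Scope classical_set_scope.
Local Open Scope complex_scope.
Local Open Scope ring_scope.

(* The norm topology of the complex numbers, needed for limits in [R[i]]. *)
HB.instance Definition _ (R : realType) := NormedModule.copy R[i] R[i]^o.

(* Complex Hilbert spaces.  [dot] is antilinear in its first and linear in its
   second argument (antilinearity in the first follows from [dotC]); the norm,
   hence the topology, is the one induced by [dot], and has values in [R[i]]. *)
HB.mixin Record isHilbert (R : realType) V & CompleteNormedModule R[i] V := {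
  dot : V -> V -> R[i];
  dot_linear : forall x a y z, dot x (a *: y + z) = a * dot x y + dot x z;
  dotC : forall x y, dot x y = (dot y x)^*%C;
  dotxx : forall x, dot x x = `|x| ^+ 2
}.

#[short(type="hilbertType")]
HB.structure Definition Hilbert (R : realType) :=
  {V of CompleteNormedModule R[i] V & isHilbert R V}.

Section Span.
Context {R : realType} {V : lmodType R[i]}.

Definition linspan (A : set V) : set V :=
  [set x | exists (n : nat) (c : 'I_n -> R[i]) (a : 'I_n -> V),
     (forall i, A (a i)) /\ x = \sum_(i < n) c i *: a i].

Definition is_subspace (A : set V) : Prop :=
  A 0 /\ forall a x y, A x -> A y -> A (a *: x + y).

End Span.

(* An unbounded operator from X to Y is represented by its graph, a subset of
   X * Y : [A (x, y)] reads "x is in the domain of A and A x = y". *)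
Section Operators.
Context {R : realType}.
Implicit Types X Y : hilbertType R.

Definition dom X Y (A : set (X * Y)) : set X := [set x | exists y, A (x, y)].

Definition is_operator X Y (A : set (X * Y)) : Prop :=
  is_subspace A /\ forall y, A (0, y) -> y = 0.

Definition densely_defined X Y (A : set (X * Y)) : Prop :=
  is_operator A /\ dense (dom A).

Definition adjoint X Y (A : set (X * Y)) : set (Y * X) :=
  [set p | forall u v, A (u, v) -> dot v p.1 = dot u p.2].

(* Domain: the intersection of the two domains. *)
Definition op_add X Y (A B : set (X * Y)) : set (X * Y) :=
  [set p | exists y z, [/\ A (p.1, y), B (p.1, z) & p.2 = y + z]].

Definition op_id X : set (X * X) := [set p | p.2 = p.1].

Definition symmetric_op X (A : set (X * X)) : Prop :=
  densely_defined A /\ A `<=` adjoint A.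

Definition self_adjoint X (A : set (X * X)) : Prop :=
  densely_defined A /\ adjoint A = A.

(* In [R[i]], [a <= b] forces [b - a] to be real. *)
Definition nonnegative_op X (A : set (X * X)) : Prop :=
  forall x y, A (x, y) -> 0 <= dot x y.

Definition bounded_below X (A : set (X * X)) : Prop :=
  exists c : R, forall x y, A (x, y) -> c%:C * `|x| ^+ 2 <= dot x y.

Definition kernel X Y (A : set (X * Y)) : set X := [set x | A (x, 0)].

Definition resolvent_set X (A : set (X * X)) : set R[i] :=
  [set l | (forall y, exists! x, A (x, y + l *: x)) /\
           exists M : R, forall x y, A (x, y) ->
             `|x| <= M%:C * `|y - l *: x|].

(* The real points of the spectrum; for a self-adjoint operator, the only case
   in which it is used, this is the whole spectrum. *)
Definition spectrum X (A : set (X * X)) : set R :=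
  [set l | ~ resolvent_set A l%:C].

Definition eigenspace X (A : set (X * X)) (l : R) : set X :=
  [set x | A (x, l%:C *: x)].

(* Isolated points of the spectrum that are eigenvalues of finite
   multiplicity. *)
Definition discrete_spectrum X (A : set (X * X)) : set R :=
  [set l | [/\ isolated (spectrum A) l,
     (exists2 x, eigenspace A l x & x != 0) &
     exists (n : nat) (e : 'I_n -> X), eigenspace A l `<=` linspan (range e)]].

Definition ess_spectrum X (A : set (X * X)) : set R :=
  spectrum A `\` discrete_spectrum A.

(* The restriction of Z to M is the weak commutator of A and B on M. *)
Definition is_weak_commutator X (A B : set (X * X)) (M : set X)
    (Z : set (X * X)) : Prop :=
  [/\ [/\ densely_defined A, densely_defined B & is_operator Z],
      [/\ is_subspace M, dense M &
          M `<=` dom Z `&` dom A `&` dom (adjoint A) `&`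
                 dom B `&` dom (adjoint B)] &
      forall f g af bf ag bg zg, M f -> M g ->
        adjoint A (f, af) -> adjoint B (f, bf) ->
        A (g, ag) -> B (g, bg) -> Z (g, zg) ->
        dot af bg - dot bf ag = dot f zg].

Definition weak_commutator_exists X (A B : set (X * X)) (M : set X) : Prop :=
  exists Z, is_weak_commutator A B M Z.

(* The graph of [A, B] on M; all admissible Z coincide on M, as M is dense. *)
Definition weak_commutator X (A B : set (X * X)) (M : set X) : set (X * X) :=
  [set p | M p.1 /\ exists2 Z, is_weak_commutator A B M Z & Z p].

End Operators.

(* Hilbert-space tensor products, tensor powers and direct sums are determined
   up to a unique compatible unitary by the inner products of their generating
   vectors and the totality of these; the following structures are the
   realizations of these spaces. *)
Section TensorProduct.
Context {R : realType}.

Record tensor_product (X Y : hilbertType R) := TensorProduct {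
  tensor_space :> hilbertType R;
  tensor : {bilinear X -> Y -> tensor_space};
  dot_tensor : forall x1 y1 x2 y2,
    dot (tensor x1 y1) (tensor x2 y2) = dot x1 x2 * dot y1 y2;
  tensor_total : dense (linspan [set tensor p.1 p.2 | p in [set: X * Y]])
}.

(* For n = 0 the space is spanned by the unit vector [tpow] of the empty
   family, i.e. it is a copy of the complex numbers. *)
Record tensor_power (X : hilbertType R) (n : nat) := TensorPower {
  tpow_space :> hilbertType R;
  tpow : ('I_n -> X) -> tpow_space;
  tpow_linear : forall (f : 'I_n -> X) (i : 'I_n),
    linear (fun x : X => tpow [eta f with i |-> x]);
  dot_tpow : forall f g : 'I_n -> X,
    dot (tpow f) (tpow g) = \prod_(i < n) dot (f i) (g i);
  tpow_total : dense (linspan (range tpow))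
}.

(* The direct sum of the subspaces S n of Y n; the embedding [summand n] is
   only meaningful on S n. *)
Record hilbert_sum (Y : nat -> hilbertType R) (S : forall n, set (Y n)) :=
  HilbertSum {
  sum_space :> hilbertType R;
  summand : forall n, Y n -> sum_space;
  summand_linear : forall n a x y, S n x -> S n y ->
    summand (a *: x + y) = a *: summand x + summand y;
  dot_summand : forall n x y, S n x -> S n y ->
    dot (summand x) (summand y) = dot x y;
  summand_orthogonal : forall n m x y, n <> m -> S n x -> S m y ->
    dot (summand x) (summand y) = 0;
  summand_total : dense (linspan (\bigcup_n (@summand n @` S n)))
}.

(* A (x) B, the closure of the algebraic tensor product of A and B. *)
Definition op_tensor (X Y : hilbertType R) (H : tensor_product X Y)
    (A : set (X * X)) (B : set (Y * Y)) : set (H * H) :=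
  closure (linspan [set p : H * H | exists x x' y y',
    [/\ A (x, x'), B (y, y') & p = (tensor H x y, tensor H x' y')]]).

End TensorProduct.

Section FermionFock.
Context {R : realType} {X : hilbertType R}.

(* The antisymmetrization (1/n!) sum_s sgn(s) f_s(1) (x) ... (x) f_s(n) of
   f_1 (x) ... (x) f_n. *)
Definition antisymmetrize n (T : tensor_power X n) (f : 'I_n -> X) : T :=
  (n`!%:R : R[i])^-1 *:
    \sum_(s : 'S_n) ((-1) ^+ s : R[i]) *: tpow T (f \o s).

Definition antisymmetric_power n (T : tensor_power X n) : set T :=
  closure (linspan (range (antisymmetrize T))).

End FermionFock.

Record fermion_fock (R : realType) (X : hilbertType R) := FermionFock {
  fock_power : forall n, tensor_power X n;
  fock_sum :> hilbert_sum (fun n => antisymmetric_power (T := fock_power n))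
}.

Section FockOperators.
Context {R : realType} {X : hilbertType R} (F : fermion_fock X).

(* The antisymmetrized product of f_1, ..., f_n as a vector of F; in the usual
   notation, B^*(f_1) ... B^*(f_n) Omega = sqrt(n!) * wedge f, and the Fock
   vacuum Omega is [wedge] of the empty family. *)
Definition wedge n (f : 'I_n -> X) : F :=
  summand F (antisymmetrize (fock_power F n) f).

Definition fcons (x : X) n (f : 'I_n -> X) (i : 'I_n.+1) : X :=
  oapp f x (unlift ord0 i).

(* Bounded, with (B^*(f) Psi)^(n+1) = sqrt(n+1) A_(n+1) (f (x) Psi^(n)); being
   continuous it is the closure of its restriction to the span of the
   vectors [wedge g]. *)
Definition creation (f : X) : set (F * F) :=
  closure (linspan [set p : F * F | exists (n : nat) (g : 'I_n -> X),
    p = (wedge g, (Num.sqrt (n.+1%:R : R))%:C *: wedge (fcons f g))]).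

Definition annihilation (f : X) : set (F * F) := adjoint (creation f).

(* The operators on the n-particle spaces being sums of
   I (x) ... (x) A (x) ... (x) I, closed, on antisymmetrized products of
   vectors f_1, ..., f_n of the domain of A.  For self-adjoint A this span is
   a core of the second quantization. *)
Definition second_quantization (A : set (X * X)) : set (F * F) :=
  closure (linspan [set p : F * F | exists (n : nat) (f g : 'I_n -> X),
    (forall i, A (f i, g i)) /\
    p = (wedge f, \sum_(j < n) wedge [eta f with j |-> g j])]).

End FockOperators.

Arguments op_id {R} X.
Arguments op_tensor {R X Y} H A B.
Arguments creation {R X} F f.
Arguments annihilation {R X} F f.
Arguments second_quantization {R X} F A.

(* Main.v *)
(** Let [l] be in the essential spectrum of [K] and [h n] an orthonormal Weyl
    sequence for [K] at [l].  The creation operators a*(h n) tend weakly to 0,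
    and since a(h n) tends strongly to 0, the anticommutation relations give
    |a*(h n) Psi| -> |Psi|.  For a unit vector Psi with (H - m) Psi small, [m]
    close to E0,
      (H - E0 - l) a*(h n) Psi = a*(h n) (H - E0) Psi + a*((K - l) h n) Psi
                                 + [HI, a*(h n)] Psi,
    so the vectors a*(h n) Psi are asymptotically orthogonal to any given finite
    set and are approximate eigenvectors of H at E0 + l.

    No spectral theorem is needed for the two halves of Weyl's criterion.  If
    A - l is bounded below on the orthogonal complement of finitely many
    vectors, these can be removed one by one as long as the kernel is trivial,
    which shows that [l] is at worst a discrete eigenvalue.  Conversely, if the
    punctured d-neighbourhood of [l] is in the resolvent set of A, then
    d |<x, (A - l) x>| <= |(A - l) x| ^ 2, and polarization yields
    d * dist (x, ker (A - l)) <= |(A - l) x|. *)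
Require Import Defs.
From HB Require Import structures.
From mathcomp Require Import all_boot all_order all_algebra fingroup perm.
From mathcomp Require Import complex ring lra.
From mathcomp Require Import boolp classical_sets functions reals topology.
From mathcomp Require Import interval_inference prodnormedzmodule normedtype sequences.

Import Order.TTheory GRing.Theory Num.Theory.
Import numFieldNormedType.Exports.
Import ProdNormedZmodule.Exports.

Local Open Scope classical_set_scope.
Local Open Scope complex_scope.
Local Open Scope ring_scope.
Set Implicit Arguments.
Unset Strict Implicit.
Unset Printing Implicit Defensive.

(** * Real-valued norms and inner products *)

(** The displayed commutator identity hides a domain question: nothing places a*(h n) Psi in the
    domain of H, and the commutator with HI is given only weakly. Both points are settled together.
    The identity is proved in the form <H u, a*(h n) Psi> = <u, y n> for every u in dom H, and the
    maximality of a self-adjoint operator turns it into membership of (a*(h n) Psi, y n) in the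
    graph of H. Thus only matrix elements of H0 against creation operators are computed.

    The operators are graphs given as closures of spans, so each identity is checked on the products
    of a wedge with a vector of TT and then carried over, because the pairs satisfying it form a
    closed subspace. On these products the anticommutation relation is an expansion of Gram
    determinants. It is used twice: the positivity of the annihilation term gives |a*(h)| <= |h|,
    hence an everywhere defined map, and the vanishing of that term along the Weyl sequence gives
    the limit of the norms. *)

Section RealNorm.
Context {R : realType}.
Local Notation C := R[i].

(** Norms take values in [R[i]], whose order is only partial. The real part loses nothing ([nrmE])
    and makes all comparisons total. *)
Definition nrm (V : normedModType C) (x : V) : R := complex.Re `|x|.

Lemma nrmE (V : normedModType C) (x : V) : `|x| = (nrm x)%:C.
Proof.
rewrite /nrm; have := normr_ge0 x; case: (`|x|) => a b.
by rewrite lecE /= => /andP[/eqP -> _].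
Qed.

Lemma nrm_ge0 (V : normedModType C) (x : V) : 0 <= nrm x.
Proof. by rewrite -ler0c -nrmE normr_ge0. Qed.

Lemma nrm0 (V : normedModType C) : nrm (0 : V) = 0.
Proof. by rewrite /nrm normr0. Qed.

Lemma nrm0_eq0 (V : normedModType C) (x : V) : nrm x = 0 -> x = 0.
Proof. by move=> x0; apply/eqP; rewrite -normr_eq0 nrmE x0. Qed.

Lemma nrm_gt0 (V : normedModType C) (x : V) : x != 0 -> 0 < nrm x.
Proof.
move=> x0; rewrite lt_neqAle nrm_ge0 andbT eq_sym.
by apply: contra_neq x0 => /nrm0_eq0.
Qed.

Lemma nrmN (V : normedModType C) (x : V) : nrm (- x) = nrm x.
Proof. by rewrite /nrm normrN. Qed.

Lemma nrmD (V : normedModType C) (x y : V) : nrm (x + y) <= nrm x + nrm y.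
Proof. by have := ler_normD x y; rewrite !nrmE -rmorphD lecR. Qed.

Lemma nrmB (V : normedModType C) (x y : V) : nrm (x - y) <= nrm x + nrm y.
Proof. by rewrite -(nrmN y) nrmD. Qed.

Lemma nrmBC (V : normedModType C) (x y : V) : nrm (x - y) = nrm (y - x).
Proof. by rewrite -nrmN opprB. Qed.

Lemma nrm_triangle (V : normedModType C) (z x y : V) :
  nrm (x - y) <= nrm (x - z) + nrm (z - y).
Proof. by have := nrmD (x - z) (z - y); rewrite addrA subrK. Qed.

Lemma nrmZ (V : normedModType C) (c : C) (x : V) :
  nrm (c *: x) = nrm c * nrm x.
Proof. by apply: complexI; rewrite -nrmE normrZ !nrmE rmorphM. Qed.

Lemma nrmM (c d : C) : nrm (c * d) = nrm c * nrm d.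
Proof. exact: nrmZ. Qed.

Lemma nrm_real (r : R) : nrm (r%:C : C) = `|r|.
Proof.
apply: complexI; rewrite -nrmE normc_def /= expr0n /= addr0 sqrtr_sqr.
by [].
Qed.

Lemma nrm1 : nrm (1 : C) = 1.
Proof. by rewrite (nrm_real 1) normr1. Qed.

Lemma nrm_nat n : nrm (n%:R : C) = n%:R.
Proof. by rewrite -(rmorph_nat (real_complex R)) nrm_real normr_nat. Qed.

Lemma nrmJ (c : C) : nrm c^*%C = nrm c.
Proof.
by apply: complexI; rewrite -!nrmE !normc_def; case: c => a b /=; rewrite sqrrN.
Qed.

Lemma nrm_sqr (c : C) : (nrm c ^+ 2)%:C = c * c^*%C.
Proof.
rewrite rmorphXn /= -nrmE -add_Re2_Im2; case: c => a b /=.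
by apply/eqP; rewrite eq_complex /=; apply/andP; split; apply/eqP; ring.
Qed.

Lemma ler_nrm_sum (V : normedModType C) (I : Type) (r : seq I) (P : pred I)
    (f : I -> V) : nrm (\sum_(i <- r | P i) f i) <= \sum_(i <- r | P i) nrm (f i).
Proof.
elim/big_ind2: _ => [|x a y b xa yb|//]; first by rewrite nrm0.
exact: le_trans (nrmD _ _) (lerD xa yb).
Qed.

Lemma conjcM (c d : C) : (c * d)^*%C = c^*%C * d^*%C.
Proof. exact: (rmorphM (@conjc R)). Qed.

End RealNorm.

Section Dot.
Context {R : realType} {X : hilbertType R}.
Local Notation C := R[i].
Implicit Types (x y z : X) (c : C).

Lemma dotDr x y z : dot x (y + z) = dot x y + dot x z.
Proof. by rewrite -[y]scale1r dot_linear mul1r scale1r. Qed.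

Lemma dot0r x : dot x 0 = 0.
Proof. by apply: (addrI (dot x 0)); rewrite -dotDr !addr0. Qed.

Lemma dotZr c x y : dot x (c *: y) = c * dot x y.
Proof. by rewrite -[c *: y]addr0 dot_linear dot0r addr0. Qed.

Lemma dotNr x y : dot x (- y) = - dot x y.
Proof. by rewrite -scaleN1r dotZr mulN1r. Qed.

Lemma dotBr x y z : dot x (y - z) = dot x y - dot x z.
Proof. by rewrite dotDr dotNr. Qed.

Lemma dotDl x y z : dot (x + y) z = dot x z + dot y z.
Proof. by rewrite dotC dotDr rmorphD /= -!dotC. Qed.

Lemma dotZl c x y : dot (c *: x) y = c^*%C * dot x y.
Proof. by rewrite dotC dotZr rmorphM /= -dotC. Qed.

Lemma dot0l x : dot 0 x = 0.
Proof. by rewrite dotC dot0r conjc0. Qed.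

Lemma dotNl x y : dot (- x) y = - dot x y.
Proof. by rewrite dotC dotNr rmorphN /= -dotC. Qed.

Lemma dotBl x y z : dot (x - y) z = dot x z - dot y z.
Proof. by rewrite dotDl dotNl. Qed.

Lemma dot_sumr (I : Type) (r : seq I) (P : pred I) (f : I -> X) x :
  dot x (\sum_(i <- r | P i) f i) = \sum_(i <- r | P i) dot x (f i).
Proof.
by elim/big_rec2: _ => [|i a b _ <-]; rewrite ?dot0r ?dotDr.
Qed.

Lemma dot_suml (I : Type) (r : seq I) (P : pred I) (f : I -> X) x :
  dot (\sum_(i <- r | P i) f i) x = \sum_(i <- r | P i) dot (f i) x.
Proof.
by elim/big_rec2: _ => [|i a b _ <-]; rewrite ?dot0l ?dotDl.
Qed.

Lemma dot_nrm x : dot x x = (nrm x ^+ 2)%:C.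
Proof. by rewrite dotxx nrmE rmorphXn. Qed.

Lemma dot_eq0 x : dot x x = 0 -> x = 0.
Proof.
rewrite dot_nrm => /complexI/eqP; rewrite expf_eq0 /= => /eqP.
exact: nrm0_eq0.
Qed.

Lemma nrm_dotC x y : nrm (dot x y) = nrm (dot y x).
Proof. by rewrite dotC nrmJ. Qed.

Lemma nrm_sqrD x y :
  nrm (x + y) ^+ 2 = nrm x ^+ 2 + 2 * complex.Re (dot x y) + nrm y ^+ 2.
Proof.
apply: complexI; rewrite -dot_nrm !dotDl !dotDr !rmorphD /= -!dot_nrm rmorphM /=.
have -> : dot y x = (dot x y)^*%C by rewrite dotC.
by rewrite !addrA -[_ + dot x y + _]addrA addcJ rmorphMn.
Qed.

Lemma nrm_sqrB x y :
  nrm (x - y) ^+ 2 = nrm x ^+ 2 - 2 * complex.Re (dot x y) + nrm y ^+ 2.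
Proof. by rewrite nrm_sqrD nrmN dotNr raddfN /= mulrN. Qed.

Lemma pythagoras x y : dot x y = 0 ->
  nrm (x + y) ^+ 2 = nrm x ^+ 2 + nrm y ^+ 2.
Proof. by rewrite nrm_sqrD => -> /=; rewrite mulr0 addr0. Qed.

Lemma parallelogram x y :
  nrm (x + y) ^+ 2 + nrm (x - y) ^+ 2 = 2 * (nrm x ^+ 2 + nrm y ^+ 2).
Proof. by rewrite nrm_sqrD nrm_sqrB; ring. Qed.

Lemma cauchy_schwarz x y : nrm (dot x y) <= nrm x * nrm y.
Proof.
have [->|y0] := eqVneq y 0; first by rewrite dot0r !nrm0 mulr0.
have ny := nrm_gt0 y0.
(* [c *: y] is the orthogonal projection of [x] on the line of [y]; the inequality is Pythagoras for
   this decomposition. *)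
pose c := ((nrm y ^+ 2)^-1)%:C * dot y x.
have ny2 : (nrm y ^+ 2)%:C != 0 :> C.
  by rewrite (inj_eq (@complexI R) _ 0) expf_eq0 /= gt_eqF.
have orth : dot (x - c *: y) (c *: y) = 0.
  rewrite dotBl !dotZr dotZl dot_nrm.
  have -> : dot x y = c^*%C * (nrm y ^+ 2)%:C.
    rewrite /c conjcM -dotC conjc_real fmorphV mulrAC mulVf //.
    by rewrite mul1r.
  by rewrite subrr.
have := pythagoras orth; rewrite subrK nrmZ => e.
have : nrm c = nrm (dot x y) / nrm y ^+ 2.
  apply: (mulIf (x := nrm y ^+ 2)); first by rewrite expf_eq0 /= gt_eqF.
  rewrite -mulrA mulVf ?mulr1; last by rewrite expf_eq0 /= gt_eqF.
  have := nrmM c (nrm y ^+ 2)%:C.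
  rewrite /c fmorphV mulrAC mulVf // mul1r nrm_dotC nrm_real.
  by rewrite ger0_norm ?exprn_ge0 ?nrm_ge0.
move=> ec; move: e; rewrite ec => e.
have h : (nrm (dot x y) / nrm y) ^+ 2 <= nrm x ^+ 2.
  rewrite e; have -> : nrm (dot x y) / nrm y ^+ 2 * nrm y = nrm (dot x y) / nrm y.
    by field; rewrite gt_eqF.
  by rewrite lerDr exprn_ge0 ?nrm_ge0.
move: h; rewrite ler_sqr ?nnegrE ?nrm_ge0 ?divr_ge0 ?nrm_ge0 //.
by rewrite ler_pdivrMr.
Qed.

Lemma Re_le_nrm c : complex.Re c <= nrm c.
Proof.
have := ler_norm (complex.Re c); move/le_trans; apply.
rewrite -lecR -nrmE normc_def lecR -sqrtr_sqr ler_sqrt ?lerDl ?sqr_ge0 //.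
by rewrite addr_ge0 ?sqr_ge0.
Qed.

End Dot.

(** * Closed subspaces *)

Section Topology.
Context {R : realType}.
Local Notation C := R[i].
Implicit Types V W : normedModType C.

Lemma nbhs_nrmP V (x : V) (P : set V) :
  nbhs x P <-> exists2 e : R, 0 < e & forall y, nrm (x - y) < e -> P y.
Proof.
split.
  move/nbhs_normP => [e /= e0 eP]; exists (complex.Re e).
    by move: e0; rewrite ltcE => /andP[].
  move=> y xy; apply: eP => /=; rewrite nrmE.
  by move: e0; rewrite !ltcE /= => /andP[/eqP -> _]; rewrite eqxx.
move=> [e e0 eP]; apply/nbhs_normP; exists e%:C => /=.
  by rewrite (ltcR 0).
by move=> y /=; rewrite nrmE ltcR; exact: eP.
Qed.

Lemma closureP V (A : set V) (x : V) :
  closure A x <-> forall e : R, 0 < e -> exists2 y, A y & nrm (x - y) < e.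
Proof.
split=> [Ax e e0|Ax B /nbhs_nrmP[e e0 eB]].
  have [|y [Ay xy]] := Ax [set y | nrm (x - y) < e]; last by exists y.
  by apply/nbhs_nrmP; exists e.
by have [y Ay xy] := Ax e e0; exists y; split => //; exact: eB.
Qed.

Lemma dense_closure V (A : set V) : dense A -> closure A = setT.
Proof.
move=> dA; apply/seteqP; split=> // x _ B.
rewrite nbhsE => -[O [oO Ox] OB]; have [|y [Oy Ay]] := dA O _ oO.
  by exists x.
by exists y; split => //; exact: OB.
Qed.

Lemma nrm_pair_lt V W (p : V * W) (e : R) :
  (nrm p < e) <-> nrm p.1 < e /\ nrm p.2 < e.
Proof.
rewrite -!(ltcR (R := R)) -!nrmE prod_normE.
rewrite !nrmE maxEle lecR; case: (leP (nrm p.1) (nrm p.2)) => h;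
  rewrite !ltcR; split=> [k|[]//]; split => //.
  exact: le_lt_trans k.
exact: lt_trans k.
Qed.

Lemma nrm_fst V W (p : V * W) : nrm p.1 <= nrm p.
Proof.
rewrite leNgt; apply/negP => h.
by have /nrm_pair_lt[] := h; rewrite ltxx.
Qed.

Lemma nrm_snd V W (p : V * W) : nrm p.2 <= nrm p.
Proof.
rewrite leNgt; apply/negP => h.
by have /nrm_pair_lt[] := h; rewrite ltxx.
Qed.

Lemma nrm_pair_le V W (p : V * W) : nrm p <= nrm p.1 + nrm p.2.
Proof.
rewrite leNgt; apply/negP => h; have : nrm p < nrm p.
  by apply/nrm_pair_lt; split; apply: le_lt_trans h; rewrite ?lerDl ?lerDr nrm_ge0.
by rewrite ltxx.
Qed.

Lemma cvg_nrmP V (u : nat -> V) (l : V) :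
  (u @ \oo --> l) <-> forall e : R, 0 < e -> \forall n \near \oo, nrm (u n - l) < e.
Proof.
split=> [ul e e0|ul].
  move/cvgrPdist_lt : ul => /(_ e%:C); rewrite (ltcR 0) => /(_ e0).
  by apply: filterS => n; rewrite nrmE ltcR nrmBC.
apply/cvgrPdist_lt => e; rewrite ltcE /= => /andP[/eqP e1 e0].
apply: filterS (ul _ e0) => n; rewrite nrmE ltcE /= e1 eqxx /=.
by rewrite nrmBC.
Qed.

Lemma complete_nrm (X : hilbertType R) (u : nat -> X) :
  (forall e : R, 0 < e -> exists N, forall m n, (N <= m)%N -> (N <= n)%N ->
     nrm (u m - u n) < e) ->
  exists l, forall e : R, 0 < e -> \forall n \near \oo, nrm (u n - l) < e.
Proof.
move=> cu; suff /cauchy_cvgP : cauchy (u @ \oo).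
  by move=> /cvg_ex[l /cvg_nrmP ul]; exists l.
apply/cauchy_exP => e; rewrite ltcE /= => /andP[/eqP e1 e0].
have [N uN] := cu _ e0; exists (u N).
exists N => // n /= Nn; rewrite -ball_normE /= nrmE ltcE /= e1 eqxx /=.
by apply: uN.
Qed.

Lemma linspan_subspace (V : lmodType C) (A : set V) : is_subspace (linspan A).
Proof.
split.
  exists 0%N, (fun=> 0), (fun=> 0); split; first by case.
  by rewrite big_ord0.
move=> a _ _ [n [c [x [Ax ->]]]] [m [d [y [Ay ->]]]].
exists (n + m)%N.
exists (fun i : 'I_(n + m) => match fintype.split i with inl j => a * c j | inr j => d j end).
exists (fun i : 'I_(n + m) => match fintype.split i with inl j => x j | inr j => y j end).
split=> [i|]; first by case: fintype.split.
rewrite big_split_ord /= scaler_sumr; congr (_ + _); apply: eq_bigr => i _.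
  by have /= -> := unsplitK (inl i : 'I_n + 'I_m); rewrite scalerA.
by have /= -> := unsplitK (inr i : 'I_n + 'I_m).
Qed.

Lemma sub_linspan (V : lmodType C) (A : set V) : A `<=` linspan A.
Proof.
move=> x Ax; exists 1%N, (fun=> 1), (fun=> x); split=> //.
by rewrite big_ord1 scale1r.
Qed.

Section Subspace.
Context {V : lmodType C} {A : set V} (hA : is_subspace A).

Lemma subspace0 : A 0. Proof. by case: hA. Qed.

Lemma subspaceD x y : A x -> A y -> A (x + y).
Proof. by move=> Ax Ay; rewrite -[x]scale1r; apply: (proj2 hA). Qed.

Lemma subspaceZ a x : A x -> A (a *: x).
Proof. by move=> Ax; rewrite -[a *: x]addr0; apply: (proj2 hA) => //; case: hA. Qed.

Lemma subspaceN x : A x -> A (- x).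
Proof. by rewrite -scaleN1r; exact: subspaceZ. Qed.

Lemma subspaceB x y : A x -> A y -> A (x - y).
Proof. by move=> Ax /subspaceN; exact: subspaceD. Qed.

Lemma subspace_sum (I : Type) (r : seq I) (P : pred I) (f : I -> V) :
  (forall i, P i -> A (f i)) -> A (\sum_(i <- r | P i) f i).
Proof. by move=> Af; elim/big_ind: _ => //; [exact: subspace0|exact: subspaceD]. Qed.

Lemma linspan_subset (B : set V) : B `<=` A -> linspan B `<=` A.
Proof.
move=> BA _ [n [c [x [Bx ->]]]]; apply: subspace_sum => i _.
by apply: subspaceZ; exact: BA.
Qed.

End Subspace.

Lemma linspan_mono (V : lmodType C) (A B : set V) :
  A `<=` B -> linspan A `<=` linspan B.
Proof.
move=> AB; apply: linspan_subset; first exact: linspan_subspace.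
by move=> x /AB; exact: sub_linspan.
Qed.

Lemma closure_subspace V (A : set V) : is_subspace A -> is_subspace (closure A).
Proof.
move=> hA; split; first by apply: subset_closure; exact: subspace0.
move=> a x y /closureP Ax /closureP Ay; apply/closureP => e e0.
have a0 : 0 < nrm a + 1 by rewrite ltr_wpDl ?nrm_ge0.
have [|x' Ax' xx'] := Ax (e / 2 / (nrm a + 1)); first by rewrite !divr_gt0.
have [|y' Ay' yy'] := Ay (e / 2); first by rewrite divr_gt0.
exists (a *: x' + y'); first by apply: (proj2 hA).
have -> : a *: x + y - (a *: x' + y') = a *: (x - x') + (y - y').
  by rewrite opprD addrACA scalerBr.
apply: le_lt_trans (nrmD _ _) _; rewrite nrmZ.
have : nrm a * nrm (x - x') <= (nrm a + 1) * nrm (x - x').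
  by rewrite ler_wpM2r ?nrm_ge0 // lerDl.
move: xx'; rewrite ltr_pdivlMr // mulrC; lra.
Qed.

(** The density principle of the whole development: a property that defines a closed subspace need
    only be checked on generators. [bounded_kernel] and [bounded_preimage] supply such subspaces. *)
Lemma closure_linspan_subset V (A B : set V) :
  is_subspace B -> closed B -> A `<=` B -> closure (linspan A) `<=` B.
Proof.
move=> hB cB AB; rewrite [X in _ `<=` X](closure_id B).1 //.
by apply: closureS; exact: linspan_subset.
Qed.

(* [s] is the identity or the complex conjugation, so that both linear and
   antilinear maps are covered. *)
Lemma bounded_kernel V W (s : C -> C) (f : V -> W) (M : R) :
  (forall a x y, f (a *: x + y) = s a *: f x + f y) ->
  (forall x, nrm (f x) <= M * nrm x) ->
  is_subspace [set x | f x = 0] /\ closed [set x | f x = 0].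
Proof.
move=> lf bf; split.
  split=> [|a x y /= fx fy]; last by rewrite lf fx fy scaler0 addr0.
  by apply: nrm0_eq0; apply/eqP; rewrite eq_le nrm_ge0 (le_trans (bf 0)) ?nrm0 ?mulr0.
rewrite closure_id; apply/seteqP; split; first exact: subset_closure.
move=> x /closureP fx /=; apply: nrm0_eq0; apply/eqP.
rewrite eq_le nrm_ge0 andbT; apply/ler_addgt0Pr => e e0; rewrite add0r.
have M0 : 0 < `|M| + 1 by rewrite ltr_wpDl.
have [|y /= fy xy] := fx (e / (`|M| + 1)); first by rewrite divr_gt0.
have -> : f x = f (1 *: (x - y) + y).
  by rewrite scale1r subrK.
have f1 : forall u, s 1 *: f u = f u - f 0.
  by move=> u; have := lf 1 u 0; rewrite scale1r addr0 => /eqP; rewrite -subr_eq => /eqP.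
have f00 : f 0 = 0.
  by apply: nrm0_eq0; apply/eqP; rewrite eq_le nrm_ge0 (le_trans (bf 0)) ?nrm0 ?mulr0.
rewrite lf f1 f00 fy subr0 addr0; apply: le_trans (bf _) _.
move: xy; rewrite ltr_pdivlMr // mulrC => /ltW; apply: le_trans.
by rewrite ler_wpM2r ?nrm_ge0 // (le_trans (ler_norm M)) // lerDl.
Qed.

Lemma closed_nrmP V (A : set V) : closed A <->
  forall x, (forall e : R, 0 < e -> exists2 y, A y & nrm (x - y) < e) -> A x.
Proof.
split=> [cA x /closureP|h]; first by rewrite -(closure_id A).1.
rewrite closure_id; apply/seteqP; split; first exact: subset_closure.
by move=> x /closureP; exact: h.
Qed.

Lemma bounded_preimage V W (f : V -> W) (M : R) (B : set W) :
  linear f -> (forall x, nrm (f x) <= M * nrm x) ->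
  is_subspace B -> closed B ->
  is_subspace (f @^-1` B) /\ closed (f @^-1` B).
Proof.
move=> lf bf hB cB.
have fB x y : f (x - y) = f x - f y.
  by rewrite addrC -scaleN1r lf scaleN1r addrC.
have f0 : f 0 = 0 by rewrite -[0](subrr (0 : V)) fB subrr.
split.
  by split=> [|a x y Bx By]; rewrite /preimage /= ?f0 ?lf; [exact: subspace0|exact: (proj2 hB)].
apply/closed_nrmP => x fx; apply: (closed_nrmP B).1 => // e e0.
have M0 : 0 < `|M| + 1 by rewrite ltr_wpDl.
have [|y By xy] := fx (e / (`|M| + 1)); first by rewrite divr_gt0.
exists (f y) => //; rewrite -fB; apply: le_lt_trans (bf _) _.
move: xy; rewrite ltr_pdivlMr // mulrC; apply: le_lt_trans.
by rewrite ler_wpM2r ?nrm_ge0 // (le_trans (ler_norm M)) // lerDl.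
Qed.

End Topology.

(** * Projections and orthonormal families *)

Section Geometry.
Context {R : realType} {X : hilbertType R}.
Local Notation C := R[i].

Lemma natSinv_lt (e : R) : 0 < e ->
  exists N, forall n, (N <= n)%N -> n.+1%:R^-1 < e.
Proof.
move=> e0; have [N _ h] := near_infty_natSinv_lt (PosNum e0).
by exists N => n Nn; exact: h.
Qed.

Lemma nearest_point_orthogonal (M : set X) (z : X) : is_subspace M ->
  (forall m, M m -> nrm z ^+ 2 <= nrm (z - m) ^+ 2) ->
  forall m, M m -> dot m z = 0.
Proof.
move=> hM zmin m Mm; apply: nrm0_eq0; set w := dot m z.
(* The best step along [m] would be 1 / |m|^2. The added 1 admits [m = 0] and still leaves a gain,
   since s |m|^2 = 1 - s. *)
pose s := (nrm m ^+ 2 + 1)^-1.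
have s0 : 0 < s by rewrite invr_gt0 ltr_wpDl ?exprn_ge0 ?nrm_ge0.
have := zmin ((s%:C * w) *: m) (subspaceZ hM _ Mm).
rewrite nrm_sqrB dotZr nrmZ nrmM nrm_real ger0_norm ?(ltW s0) //.
rewrite (_ : dot z m = w^*%C); last by rewrite /w -dotC.
rewrite -mulrA -nrm_sqr -rmorphM /=.
have sm : s * nrm m ^+ 2 = 1 - s.
  have : s * (nrm m ^+ 2 + 1) = 1.
    by rewrite mulVf // gt_eqF // ltr_wpDl ?exprn_ge0 ?nrm_ge0.
  by rewrite mulrDr mulr1; lra.
rewrite (_ : (s * nrm w * nrm m) ^+ 2 = s * nrm w ^+ 2 * (s * nrm m ^+ 2)); last by ring.
rewrite sm => h; have w0 := exprn_ge0 2 (nrm_ge0 w).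
have : s * nrm w ^+ 2 <= 0 by have := mulr_ge0 (ltW s0) (mulr_ge0 (ltW s0) w0); lra.
by rewrite pmulr_rle0 // => k; apply/eqP; rewrite -sqrf_eq0 eq_le k w0.
Qed.

(** A minimizing sequence is Cauchy by the parallelogram law, because midpoints stay in [M]; its
    limit is a nearest point, hence the foot of the perpendicular. *)
Lemma projection (M : set X) (x : X) : is_subspace M -> closed M ->
  exists2 a, M a & forall m, M m -> dot m (x - a) = 0.
Proof.
move=> hM cM; pose D := [set nrm (x - m) ^+ 2 | m in M].
have D0 : D !=set0 by exists (nrm (x - 0) ^+ 2), 0 => //; exact: subspace0.
have lD : lbound D 0 by move=> _ [m _ <-]; rewrite exprn_ge0 ?nrm_ge0.
have iD : has_inf D by split => //; exists 0.
pose d := inf D.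
have dle m : M m -> d <= nrm (x - m) ^+ 2.
  by move=> Mm; apply: ge_inf; [exists 0|exists m].
have /choice[u uP] : forall n, exists m, M m /\ nrm (x - m) ^+ 2 < d + n.+1%:R^-1.
  move=> n; have [|_ [m Mm <-] ?] := @inf_adherent _ D n.+1%:R^-1 _ iD.
    by rewrite invr_gt0.
  by exists m.
have cu : forall e : R, 0 < e -> exists N, forall m n, (N <= m)%N -> (N <= n)%N ->
    nrm (u m - u n) < e.
  move=> e e0; have [|N hN] := @natSinv_lt (e ^+ 2 / 4); first by rewrite divr_gt0 ?exprn_gt0.
  exists N => m n Nm Nn.
  have := parallelogram (x - u m) (x - u n).
  have -> : x - u m - (x - u n) = - (u m - u n) by rewrite opprB addrC subrKA opprB.
  rewrite nrmN; have -> : x - u m + (x - u n) = 2%:R *: (x - 2^-1 *: (u m + u n)).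
    rewrite scalerBr scalerA divff ?pnatr_eq0 // scale1r scaler_nat mulr2n.
    by rewrite opprD addrACA.
  rewrite nrmZ nrm_nat exprMn.
  have := dle _ (subspaceZ hM 2^-1 (subspaceD hM (uP m).1 (uP n).1)).
  have := hN _ Nm; have := hN _ Nn; have := (uP m).2; have := (uP n).2.
  rewrite -[_ < e]ltr_sqr ?nnegrE ?nrm_ge0 ?(ltW e0) //.
  move: (d) (m.+1%:R^-1) (n.+1%:R^-1) => d' a b.
  lra.
have [a ua] := complete_nrm cu.
have Ma : M a.
  apply: (closed_nrmP _).1 cM _ _ => e /ua[N _ h].
  by exists (u N); [exact: (uP N).1|by rewrite nrmBC; apply: h => /=].
exists a => //; apply: nearest_point_orthogonal => // m Mm.
have -> : x - a - m = x - (a + m) by rewrite opprD addrA.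
apply: le_trans (dle _ (subspaceD hM Ma Mm)).
apply/ler_addgt0Pr => e e0.
(* [q] will bound both |u n - a| and the excess of |x - u n|^2 over [d]. Expanding (|x - u n| + q)^2
   then costs q (2 |x - a| + 3 q + 1), and for q <= 1 the bracket is at most [b]. *)
have [q q0 qe] : exists2 q : R, 0 < q & q * (2 * nrm (x - a) + 3 * q + 1) <= e.
  pose b := 2 * nrm (x - a) + 4; have b0 : 0 < b by rewrite ltr_wpDl ?mulr_ge0 ?nrm_ge0.
  exists (Num.min 1 (e / b)); first by rewrite lt_min ltr01 divr_gt0.
  set q := Num.min _ _; have q1 : q <= 1 by rewrite ge_min lexx.
  have qb : q * b <= e by rewrite -ler_pdivlMr // ge_min lexx orbT.
  have q0 : 0 < q by rewrite lt_min ltr01 divr_gt0.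
  by apply: le_trans qb; rewrite ler_pM2l // /b; lra.
have [N1 _ h1] := ua q q0; have [N2 h2] := natSinv_lt q0.
pose n := maxn N1 N2.
have := h1 n (leq_maxl _ _); have := h2 n (leq_maxr _ _); have := (uP n).2 => /=.
have := nrm_triangle (u n) x a; have := nrm_triangle a x (u n); rewrite (nrmBC a).
have := nrm_ge0 (x - u n); have := nrm_ge0 (x - a); have := nrm_ge0 (u n - a).
move: (nrm (x - a)) (nrm (x - u n)) (nrm (u n - a)) (n.+1%:R^-1) (d) qe => A P s t d'.
move=> qe s0 A0 P0 PA AP Pd tq sq.
have : A ^+ 2 <= (P + q) ^+ 2 by rewrite ler_sqr ?nnegrE //; lra.
have : P * q <= (A + q) * q by rewrite ler_pM2r //; lra.
lra.
Qed.

(** Bessel's inequality: removing the components along the [h i] one after the other bounds the sum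
    of the squared coefficients by |k|^2, so the coefficients tend to 0. *)
Lemma bessel_weak0 (h : nat -> X) :
  (forall n, nrm (h n) = 1) -> (forall i j, (i < j)%N -> dot (h i) (h j) = 0) ->
  forall k (e : R), 0 < e -> \forall n \near \oo, nrm (dot k (h n)) < e.
Proof.
move=> h1 horth k e e0.
pose c n := dot (h n) k.
pose r n := k - \sum_(i < n) c i *: h i.
have rE n : dot (h n) (r n) = c n.
  rewrite /r dotBr dot_sumr big1 ?subr0 // => i _.
  by rewrite dotZr dotC horth // conjc0 mulr0.
have step n : nrm (r n) ^+ 2 = nrm (r n.+1) ^+ 2 + nrm (c n) ^+ 2.
  have -> : r n = r n.+1 + c n *: h n.
    by rewrite /r big_ord_recr /= opprD addrA subrK.
  rewrite pythagoras ?nrmZ ?h1 ?mulr1 //.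
  rewrite dotZr dotC.
  have -> : r n.+1 = r n - c n *: h n by rewrite /r big_ord_recr /= opprD addrA.
  by rewrite dotBr dotZr rE dot_nrm h1 expr1n mulr1 subrr conjc0 mulr0.
have tot n : series (fun n => nrm (c n) ^+ 2) n <= nrm k ^+ 2.
  suff -> : nrm k ^+ 2 = series (fun n => nrm (c n) ^+ 2) n + nrm (r n) ^+ 2.
    by rewrite lerDl exprn_ge0 ?nrm_ge0.
  elim: n => [|n IH]; first by rewrite /series /= big_nil add0r /r big_ord0 subr0.
  by rewrite seriesSr IH step; ring.
have cs : cvgn (series (fun n => nrm (c n) ^+ 2)).
  apply: nondecreasing_is_cvgn.
    by apply/nondecreasing_seqP => n; rewrite seriesSr lerDl exprn_ge0 ?nrm_ge0.
  by exists (nrm k ^+ 2) => _ [n _ <-]; exact: tot.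
have /cvgrPdist_lt /(_ (e ^+ 2)) := cvg_series_cvg_0 cs.
rewrite exprn_gt0 // => /(_ isT); apply: filterS => n.
rewrite sub0r normrN ger0_norm ?exprn_ge0 ?nrm_ge0 // nrm_dotC.
by rewrite ltr_sqr ?nnegrE ?nrm_ge0 ?ltW.
Qed.

(** Orthogonalization in which dependent vectors are dropped, so [e] may be any finite family. Only
    the reproducing formula is recorded: it bounds a vector of the span by its inner products with
    [s]. *)
Lemma gram_schmidt n (e : 'I_n -> X) : exists s : seq X,
  (forall f, f \in s -> linspan (range e) f) /\
  forall b, linspan (range e) b -> b = \sum_(f <- s) dot f b *: f.
Proof.
elim: n e => [|n IH] e.
  exists [::]; split=> // _ [m [c [a [aP ->]]]].
  by case: m c a aP => [|m] c a aP; [rewrite big_ord0 big_nil|case: (aP ord0) => -[]].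
have [s [sS sP]] := IH (e \o lift ord0).
set S := linspan (range (e \o lift ord0)) in sS sP.
have hS : is_subspace S := linspan_subspace _.
have SS' : S `<=` linspan (range e).
  by apply: linspan_mono => _ [i _ <-]; exists (lift ord0 i).
have hS' := linspan_subspace (range e).
pose v := e ord0.
have vS : linspan (range e) v by apply: sub_linspan; exists ord0.
have S'E b : linspan (range e) b -> exists c, S (b - c *: v).
  move=> [m [c [a [aP ->]]]].
  have : linspan (range e) `<=` [set x | exists d, S (x - d *: v)].
    apply: linspan_subset.
      split; first by exists 0; rewrite scale0r subr0; exact: subspace0.
      move=> d x y [dx Sx] [dy Sy]; exists (d * dx + dy).
      have -> : d *: x + y - (d * dx + dy) *: v = d *: (x - dx *: v) + (y - dy *: v).
        by rewrite scalerDl opprD addrACA scalerBr scalerA.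
      by apply: (proj2 hS).
    move=> _ [i _ <-]; case: (unliftP ord0 i) => [j|] ->.
      by exists 0; rewrite scale0r subr0; apply: sub_linspan; exists j.
    by exists 1; rewrite scale1r subrr; exact: subspace0.
  by apply; exists m, c, a.
pose p := \sum_(f <- s) dot f v *: f.
have Sp : S p by rewrite /p big_seq; apply: subspace_sum => // f /sS; exact: subspaceZ.
pose w := v - p.
have wS b : S b -> dot w b = 0.
  move=> Sb; rewrite /w /p dotBl dot_suml {1}(sP b Sb) dot_sumr.
  rewrite -sumrB big1 // => f _.
  by rewrite dotZr dotZl -dotC mulrC subrr.
have dec b c : S (b - c *: v) ->
    b = \sum_(f <- s) dot f b *: f + c *: w.
  move=> Sb; rewrite /w scalerBr /p.
  have {1}-> : b = (b - c *: v) + c *: v by rewrite subrK.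
  rewrite {1}(sP _ Sb) scaler_sumr.
  under eq_bigr do rewrite dotBr dotZr scalerBl -scalerA.
  rewrite sumrB; move: (\sum_(f <- s) c *: _) => t.
  by rewrite -addrA [- t + _]addrC.
have [w0|w0] := eqVneq w 0.
  exists s; split=> [f /sS/SS' //|b /S'E[c /dec]].
  by rewrite w0 scaler0 addr0.
pose g := ((nrm w)^-1)%:C *: w.
exists (g :: s); split=> [f|b /S'E[c Sb]].
  rewrite inE => /orP[/eqP->|/sS/SS' //].
  by apply: subspaceZ => //; apply: subspaceB => //; exact: SS'.
rewrite big_cons addrC [LHS](dec _ _ Sb); congr (_ + _).
rewrite /g scalerA dotZl conjc_real; congr (_ *: _).
have -> : b = (b - c *: v) + c *: (w + p) by rewrite /w !subrK.
rewrite dotDr wS // add0r dotZr dotDr [dot w p]wS // addr0 dot_nrm.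
have nw := gt_eqF (nrm_gt0 w0).
rewrite mulrCA -!mulrA -!rmorphM /=.
rewrite (_ : _^-1 * _ = 1) ?mulr1 //.
by field; rewrite nw.
Qed.

(** Each functional <f, .> lowers the dimension by at most one: a vector [x0] on which it does not
    vanish spans a complement of its kernel in [N]. *)
Lemma finite_dim_of_separating (s : seq X) (N : set X) : is_subspace N ->
  (forall x, N x -> (forall f, f \in s -> dot f x = 0) -> x = 0) ->
  exists (n : nat) (e : 'I_n -> X), N `<=` linspan (range e).
Proof.
elim: s N => [|f s IH] N hN sep.
  exists 0%N, (fun=> 0) => x Nx; rewrite (sep x Nx) //.
  exact: subspace0 (linspan_subspace _).
have [[x0 Nx0 fx0]|fN] := pselect (exists2 x, N x & dot f x != 0); last first.
  apply: IH => // x Nx xs; apply: sep => // g; rewrite inE => /orP[/eqP->|/xs //].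
  by apply: contra_notP fN => /eqP fx; exists x.
have hN' : is_subspace [set x | N x /\ dot f x = 0].
  split; first by rewrite /= dot0r; split=> //; exact: subspace0.
  move=> a x y [Nx fx] [Ny fy]; split; first exact: (proj2 hN).
  by rewrite dotDr dotZr fx fy mulr0 addr0.
have [x [Nx fx] xs|n [e eP]] := IH _ hN'.
  by apply: sep => // g; rewrite inE => /orP[/eqP->|/xs //].
exists n.+1, (fun i => oapp e x0 (unlift ord0 i)) => x Nx.
set S := linspan _; have hS : is_subspace S := linspan_subspace _.
pose a := dot f x / dot f x0.
rewrite -(subrK (a *: x0) x); apply: subspaceD => //; last first.
  by apply/(subspaceZ hS)/sub_linspan; exists ord0 => //; rewrite unlift_none.
have : linspan (range e) `<=` S.
  by apply: linspan_mono => _ [i _ <-]; exists (lift ord0 i) => //; rewrite liftK.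
apply; apply: eP; split; first by apply: (subspaceB hN) => //; exact: subspaceZ.
by rewrite dotBr dotZr /a divfK // subrr.
Qed.

End Geometry.

(** * Spectra of self-adjoint operators *)

Section BoundBelow.
Context {R : realType} {X : hilbertType R}.
Local Notation C := R[i].

(** Suppose a bound [e1] holds on the kernel of <f, .>. Either |<f, x>| <= |z| / eta on all of [G],
    and subtracting a multiple of a fixed pair outside the kernel reduces to [e1]; or there are
    pairs in [G] with <f, x> = 1 and z tending to 0. Differences of the latter lie in the kernel, so
    the x converge to some [l] with G (l, 0). Then l = 0, against <f, l> = 1. *)
Lemma bounded_below_extend (s : seq X) (G : set (X * X)) (e : R) :
  is_subspace G -> closed G -> (forall x, G (x, 0) -> x = 0) -> 0 < e ->
  (forall x z, G (x, z) -> (forall f, f \in s -> dot f x = 0) ->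
     e * nrm x <= nrm z) ->
  exists2 e' : R, 0 < e' & forall x z, G (x, z) -> e' * nrm x <= nrm z.
Proof.
elim: s G e => [|f s IH] G e hG cG iG e0 bG.
  by exists e => // x z Gxz; exact: bG.
pose G1 := G `&` [set p | dot f p.1 = 0].
have [hk ck] : is_subspace [set p : X * X | dot f p.1 = 0] /\
    closed [set p : X * X | dot f p.1 = 0].
  apply: (@bounded_kernel _ _ _ id (fun p : X * X => dot f p.1) (nrm f)).
    by move=> a x y /=; rewrite dotDr dotZr.
  move=> p; apply: le_trans (cauchy_schwarz _ _) _.
  by rewrite ler_wpM2l ?nrm_ge0 ?nrm_fst.
have hG1 : is_subspace G1.
  split; first by split; exact: subspace0.
  by move=> a x y [? ?] [? ?]; split; [apply: (proj2 hG)|apply: (proj2 hk)].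
have [|x [Gx _]|x z [Gx /= fx] xs|e1 e10 b1] := IH G1 e hG1 _ _ e0.
- exact: closedI.
- exact: iG.
- by apply: bG => // g; rewrite inE => /orP[/eqP->|/xs].
have [[[v w] Gv /= fv]|nov] := pselect (exists2 p, G p & dot f p.1 != 0); last first.
  exists e1 => // x z Gx; apply: b1; split=> //=.
  by apply: contra_notP nov => /eqP fx; exists (x, z).
have [[eta eta0 etaP]|noeta] := pselect (exists2 eta : R, 0 < eta &
    forall x z, G (x, z) -> eta * nrm (dot f x) <= nrm z).
  pose a := (dot f v)^-1.
  have a0 : nrm (dot f v) * nrm a = 1.
    by rewrite -nrmM mulfV // nrm1.
  (* For c = <f, x>, subtracting c times (a v, a w) leads into [G1], whence e1 |x| <= |z| + |c| (|a
     w| + e1 |a v|). Inserting |c| <= |z| / eta gives e1 |x| <= Q |z|. *)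
  pose Q := (1 + (nrm (a *: w) + e1 * nrm (a *: v)) / eta).
  have Q0 : 0 < Q.
    by rewrite ltr_pwDl // divr_ge0 ?(ltW eta0) // addr_ge0 ?mulr_ge0 ?nrm_ge0 ?(ltW e10).
  exists (e1 / Q); first by rewrite divr_gt0.
  move=> x z Gx; set c := dot f x.
  have Gd : G (x - c *: (a *: v), z - c *: (a *: w)).
    have : G ((x, z) - (c * a) *: (v, w)).
      by apply: (subspaceB hG) => //; exact: (subspaceZ hG).
    by rewrite -!scalerA.
  have /b1 : G1 (x - c *: (a *: v), z - c *: (a *: w)).
    by split=> //=; rewrite dotBr !dotZr mulVf // mulr1 subrr.
  have := etaP _ _ Gx; rewrite -/c => ce.
  have := nrmB z (c *: (a *: w)); rewrite nrmZ.
  have := nrm_triangle (x - c *: (a *: v)) x 0.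
  rewrite !subr0 subKr [nrm (c *: _)]nrmZ.
  rewrite mulrAC ler_pdivrMr //.
  have cz : nrm c <= nrm z / eta by rewrite ler_pdivlMr // mulrC.
  have := ler_wpM2r (nrm_ge0 (a *: w)) cz.
  have := ler_wpM2r (mulr_ge0 (ltW e10) (nrm_ge0 (a *: v))) cz.
  rewrite /Q => h1 h2 h3 h4 h5.
  have := ler_wpM2l (ltW e10) h3.
  have -> : nrm z * (1 + (nrm (a *: w) + e1 * nrm (a *: v)) / eta) =
    nrm z + nrm z / eta * nrm (a *: w) + nrm z / eta * (e1 * nrm (a *: v)) by ring.
  lra.
exfalso.
have /choice[u uP] : forall n, exists p : X * X,
    [/\ G p, dot f p.1 = 1 & nrm p.2 < n.+1%:R^-1].
  move=> n; apply: contra_notP noeta => nu; exists n.+1%:R^-1; first by rewrite invr_gt0.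
  move=> x z Gx; rewrite leNgt; apply/negP => xz.
  have fx0 : 0 < nrm (dot f x).
    rewrite lt_neqAle nrm_ge0 andbT; apply/eqP => fx0.
    by move: xz; rewrite -fx0 mulr0 ltNge nrm_ge0.
  have fx : dot f x != 0.
    by apply/eqP => fx; move: fx0; rewrite fx nrm0 ltxx.
  apply: nu; exists ((dot f x)^-1 *: (x, z)); split.
  - exact: (subspaceZ hG).
  - by rewrite dotZr mulVf.
  rewrite nrmZ; have := nrmM (dot f x)^-1 (dot f x); rewrite mulVf // nrm1 => e1'.
  have -> : nrm (dot f x)^-1 = (nrm (dot f x))^-1.
    by rewrite -[RHS]mul1r e1' mulfK // gt_eqF.
  by rewrite mulrC ltr_pdivrMr.
have [|l ul] := @complete_nrm _ X (fun n => (u n).1).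
  move=> eps eps0; have [|N hN] := @natSinv_lt _ (e1 * eps / 2).
    by rewrite divr_gt0 // mulr_gt0.
  exists N => m n Nm Nn.
  have [Gm fm zm] := uP m; have [Gn fn zn] := uP n.
  have /b1 : G1 ((u m).1 - (u n).1, (u m).2 - (u n).2).
    split; last by rewrite /= dotBr fm fn subrr.
    by have := subspaceB hG Gm Gn; case: (u m) (u n) => ? ? [? ?].
  rewrite -(ltr_pM2l e10 (nrm _) eps).
  have := nrmB (u m).2 (u n).2; have := hN _ Nm; have := hN _ Nn.
  move: (m.+1%:R^-1) (n.+1%:R^-1) zm zn => ? ? ? ?; lra.
have l0 : l = 0.
  apply: iG; apply: (closed_nrmP G).1 => // eps eps0.
  have [N1 _ h1] := ul _ eps0; have [N2 h2] := natSinv_lt eps0.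
  pose n := maxn N1 N2; exists (u n); first by case: (uP n).
  apply/nrm_pair_lt; rewrite /= nrmBC sub0r nrmN; split.
    by apply: h1 => /=; rewrite leq_maxl.
  by case: (uP n) => _ _ /lt_trans; apply; apply: h2; rewrite leq_maxr.
have f0 : 0 < nrm f + 1 by rewrite ltr_wpDl ?nrm_ge0.
have [|N _ h] := ul (nrm f + 1)^-1; first by rewrite invr_gt0.
have := h N (leqnn _); rewrite /= l0 subr0 => hN.
have [_ fN _] := uP N.
have := cauchy_schwarz f (u N).1; rewrite fN nrm1.
have : (nrm f + 1) * nrm (u N).1 < 1.
  by rewrite mulrC -ltr_pdivlMr // mul1r.
have := nrm_ge0 (u N).1; lra.
Qed.

End BoundBelow.

(** The factorization (A - l - m)(A - l + m) = (A - l)^2 - m^2 at [w], written for A w = x + l w and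
    A x = y. *)
Lemma shifted_difference_of_squares (K : fieldType) (V : lmodType K)
    (x y w : V) (l m : K) :
  y + m *: (x + l *: w) - (l + m) *: (x + m *: w) =
  y - l *: x - (m ^+ 2) *: w.
Proof.
rewrite scalerDl opprD addrACA -scalerBr opprD [x + _ + _]addrACA subrr add0r.
by rewrite scalerBr !scalerA scalerDr opprD scalerA (mulrC m l) !addrA subrK.
Qed.

Section SelfAdjoint.
Context {R : realType} {X : hilbertType R} {A : set (X * X)}.
Hypothesis hA : self_adjoint A.
Local Notation C := R[i].

Lemma self_adjoint_subspace : is_subspace A.
Proof. by case: hA => -[[]]. Qed.

Lemma self_adjoint_sym x y u v : A (x, y) -> A (u, v) -> dot v x = dot u y.
Proof. by move=> Axy; rewrite -(proj2 hA) in Axy => Auv; exact: Axy. Qed.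

Lemma self_adjoint_max x y :
  (forall u v, A (u, v) -> dot v x = dot u y) -> A (x, y).
Proof. by move=> h; rewrite -(proj2 hA). Qed.

Lemma self_adjoint_closed : closed A.
Proof.
apply/closed_nrmP => -[x y] clA; apply: self_adjoint_max => u v Auv.
have [_ ck] : is_subspace [set p : X * X | dot v p.1 - dot u p.2 = 0] /\
    closed [set p : X * X | dot v p.1 - dot u p.2 = 0].
  apply: (@bounded_kernel _ _ _ id (fun p : X * X => dot v p.1 - dot u p.2)
    (nrm v + nrm u)).
    by move=> a p q /=; rewrite !dotDr !dotZr opprD addrACA -mulrBr.
  move=> p; apply: le_trans (nrmB _ _) _; rewrite mulrDl.
  apply: lerD; (apply: le_trans (cauchy_schwarz _ _) _).
    by rewrite ler_wpM2l ?nrm_ge0 ?nrm_fst.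
  by rewrite ler_wpM2l ?nrm_ge0 ?nrm_snd.
apply/eqP; rewrite -subr_eq0; apply/eqP.
apply: (closed_nrmP _).1 ck (x, y) _ => e /clA[p Ap xyp].
exists p => //=; rewrite (_ : dot v p.1 = dot u p.2) ?subrr //.
by apply: self_adjoint_sym => //; case: p {xyp} Ap.
Qed.

Lemma self_adjointD x y u v : A (x, y) -> A (u, v) -> A (x + u, y + v).
Proof. exact: (subspaceD self_adjoint_subspace). Qed.

Lemma self_adjointB x y u v : A (x, y) -> A (u, v) -> A (x - u, y - v).
Proof. exact: (subspaceB self_adjoint_subspace). Qed.

Lemma self_adjointZ a x y : A (x, y) -> A (a *: x, a *: y).
Proof. exact: (subspaceZ self_adjoint_subspace a). Qed.

(** The bound and the closedness of [A] make the range of A - l closed. A vector orthogonal to the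
    range lies in the kernel of A - l, since [A] is self-adjoint and [l] real, and the bound makes
    this kernel trivial; so A - l is onto. *)
Lemma resolvent_of_bound (l M : R) :
  (forall x y, A (x, y) -> nrm x <= M * nrm (y - l%:C *: x)) ->
  resolvent_set A l%:C.
Proof.
move=> bM; split; last first.
  by exists M => x y Axy; rewrite !nrmE -rmorphM lecR; exact: bM.
pose rg := [set z | exists2 x, A (x, z + l%:C *: x) & True].
have hrg : is_subspace rg.
  split; first by exists 0 => //; rewrite scaler0 addr0; exact: (subspace0 self_adjoint_subspace).
  move=> a z w [x Ax _] [u Au _]; exists (a *: x + u) => //.
  have := self_adjointD (self_adjointZ a Ax) Au.
  by rewrite !scalerDr addrACA !scalerA (mulrC a).
have cM M' (x y : X) : A (x, y + l%:C *: x) -> M <= M' -> nrm x <= M' * nrm y.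
  move=> /bM; rewrite addrK => h MM'; apply: le_trans h _.
  by rewrite ler_wpM2r ?nrm_ge0.
pose M' := `|M| + 1; have M'0 : 0 < M' by rewrite ltr_wpDl.
have MM' : M <= M' by rewrite (le_trans (ler_norm M)) // lerDl.
have crg : closed rg.
  apply/closed_nrmP => z clz.
  have /choice[u uP] : forall n, exists p : X * X,
      A (p.1, p.2 + l%:C *: p.1) /\ nrm (z - p.2) < n.+1%:R^-1.
    move=> n; have [|w [x Ax _] zw] := clz n.+1%:R^-1; first by rewrite invr_gt0.
    by exists (x, w).
  have [|x ux] := @complete_nrm _ X (fun n => (u n).1).
    move=> e e0; have [|N hN] := @natSinv_lt _ (e / M' / 2).
      by rewrite !divr_gt0.
    exists N => m n Nm Nn.
    have /cM/(_ MM') : A ((u m).1 - (u n).1,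
        ((u m).2 - (u n).2) + l%:C *: ((u m).1 - (u n).1)).
      have := self_adjointB (uP m).1 (uP n).1.
      by rewrite scalerBr opprD addrACA.
    move=> h; apply: le_lt_trans h _; rewrite mulrC -ltr_pdivlMr //.
    have := nrm_triangle z (u m).2 (u n).2; rewrite (nrmBC _ z).
    have := hN _ Nm; have := hN _ Nn; have := (uP m).2; have := (uP n).2.
    by move: (m.+1%:R^-1) (n.+1%:R^-1) => a b; lra.
  exists x => //; apply: (closed_nrmP A).1 self_adjoint_closed _ _ => e e0.
  pose q := e / (2 + `|l|); have q0 : 0 < q by rewrite divr_gt0 // ltr_pwDl.
  have qe : q * (2 + `|l|) = e by rewrite divfK // gt_eqF // ltr_pwDl.
  have lq := mulr_ge0 (ltW q0) (normr_ge0 l).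
  have [N1 _ h1] := ux _ q0; have [N2 h2] := natSinv_lt q0.
  pose n := maxn N1 N2; have := h1 n (leq_maxl _ _) => /= hn1.
  have := h2 n (leq_maxr _ _) => hn2; have [Au hz] := uP n.
  exists ((u n).1, (u n).2 + l%:C *: (u n).1) => //.
  apply/nrm_pair_lt; rewrite /= nrmBC; split; first by apply: lt_le_trans hn1 _; lra.
  rewrite opprD addrACA -scalerBr; apply: le_lt_trans (nrmD _ _) _.
  rewrite nrmZ nrm_real [nrm (x - _)]nrmBC.
  have := ler_wpM2l (normr_ge0 l) (ltW hn1); have := lt_trans hz hn2; lra.
have full z : rg z.
  have [a rga orth] := projection z hrg crg.
  suff -> : z = a by [].
  apply/eqP; rewrite -subr_eq0; apply/eqP; set b := z - a in orth *.
  have Ab : A (b, l%:C *: b).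
    apply: self_adjoint_max => u v Auv.
    have : dot (v - l%:C *: u) b = 0 by apply: orth; exists u; rewrite ?subrK.
    by rewrite dotBl dotZl conjc_real dotZr => /eqP; rewrite subr_eq0 => /eqP.
  have := bM _ _ Ab; rewrite subrr nrm0 mulr0 => b0.
  by apply: nrm0_eq0; apply/eqP; rewrite eq_le b0 nrm_ge0.
move=> y; have [x Ax _] := full y; exists x; split=> // x' Ax'.
apply/eqP; rewrite -subr_eq0; apply/eqP.
have := bM _ _ (self_adjointB Ax Ax').
rewrite opprD addrACA subrr add0r -scalerBr subrr nrm0 mulr0 => b0.
by apply: nrm0_eq0; apply/eqP; rewrite eq_le b0 nrm_ge0.
Qed.

Lemma resolvent_bound (l : R) : resolvent_set A l%:C ->
  exists2 c : R, 0 < c & forall x y, A (x, y) -> c * nrm x <= nrm (y - l%:C *: x).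
Proof.
move=> [_ [M bM]]; have M0 : 0 < `|M| + 1 by rewrite ltr_wpDl.
exists (`|M| + 1)^-1; first by rewrite invr_gt0.
move=> x y /bM; rewrite !nrmE -rmorphM lecR => h.
rewrite mulrC ler_pdivrMr //; apply: le_trans h _; rewrite mulrC ler_wpM2l ?nrm_ge0 //.
by rewrite (le_trans (ler_norm M)) // lerDl.
Qed.

(** By [resolvent_of_bound] a failing lower bound is the only obstruction to the resolvent, so every
    spectral point is an approximate eigenvalue. *)
Lemma spectrumP (l : R) : spectrum A l <->
  forall e : R, 0 < e -> exists x y, [/\ A (x, y), nrm x = 1 & nrm (y - l%:C *: x) < e].
Proof.
split=> [sl e e0|h /resolvent_bound[c c0 bc]]; last first.
  have [x [y [/bc + x1]]] := h c c0; rewrite x1 mulr1 => k /(le_lt_trans k).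
  by rewrite ltxx.
apply: contra_notP sl => nx; apply: (@resolvent_of_bound l e^-1) => x y Axy.
rewrite mulrC ler_pdivlMr // leNgt; apply/negP => xy.
have x0 : 0 < nrm x.
  rewrite lt_neqAle nrm_ge0 andbT; apply/eqP => x0.
  by move: xy; rewrite -x0 mul0r ltNge nrm_ge0.
apply: nx; exists ((nrm x)^-1%:C *: x), ((nrm x)^-1%:C *: y).
have nx : nrm ((nrm x)^-1%:C : C) = (nrm x)^-1.
  by rewrite nrm_real ger0_norm // invr_ge0 ltW.
split; first exact: self_adjointZ.
  by rewrite nrmZ nx mulVf // gt_eqF.
by rewrite scalerA mulrC -scalerA -scalerBr nrmZ nx mulrC ltr_pdivrMr // mulrC.
Qed.

(* Let m be the best lower bound of A - l and suppose m < d.  For a near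
   minimiser x and w = (A - l)^-1 x, the vector (A - l) x - m^2 w is small, and
   it equals (A - l - m)(A - l + m) w, although l + m and l - m are in the
   resolvent set. *)
Lemma resolvent_gap (l d : R) :
  (forall l' : R, `|l' - l| < d -> resolvent_set A l'%:C) ->
  forall x y, A (x, y) -> d * nrm x <= nrm (y - l%:C *: x).
Proof.
move=> gap x0 y0 Axy0; rewrite leNgt; apply/negP => xyd.
have nx0 : 0 < nrm x0.
  rewrite lt_neqAle nrm_ge0 andbT; apply/eqP => e.
  by move: xyd; rewrite -e mulr0 ltNge nrm_ge0.
have d0 : 0 < d.
  by rewrite -(pmulr_lgt0 _ nx0) (le_lt_trans (nrm_ge0 _) xyd).
pose S := [set m : R | forall x y, A (x, y) -> m * nrm x <= nrm (y - l%:C *: x)].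
pose m := sup S.
have [c c0 Sc] : exists2 c : R, 0 < c & S c.
  by apply: resolvent_bound; apply: gap; rewrite subrr normr0.
have ubS : ubound S (nrm (y0 - l%:C *: x0) / nrm x0).
  by move=> r /(_ _ _ Axy0); rewrite ler_pdivlMr.
have sS : has_sup S by split; [exists c|eexists; exact: ubS].
have md : m < d.
  apply: (@le_lt_trans _ _ (nrm (y0 - l%:C *: x0) / nrm x0)).
    by apply: ge_sup => //; exists c.
  by rewrite ltr_pdivrMr.
have cm : c <= m by apply: ub_le_sup => //; case: sS.
have m0 : 0 < m by exact: lt_le_trans cm.
have Sm x y : A (x, y) -> m * nrm x <= nrm (y - l%:C *: x).
  move=> Axy; have [x_0|xn0] := eqVneq (nrm x) 0.
    by rewrite x_0 mulr0 nrm_ge0.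
  have xp : 0 < nrm x by rewrite lt_neqAle eq_sym xn0 nrm_ge0.
  rewrite -ler_pdivlMr //; apply: ge_sup; first by exists c.
  by move=> r /(_ _ _ Axy); rewrite ler_pdivlMr.
have [c1 c10 S1] : exists2 c : R, 0 < c &
    forall x y, A (x, y) -> c * nrm x <= nrm (y - (l + m)%:C *: x).
  apply: resolvent_bound; apply: gap.
  by rewrite addrC addKr ger0_norm // ltW.
have [c2 c20 S2] : exists2 c : R, 0 < c &
    forall x y, A (x, y) -> c * nrm x <= nrm (y - (l - m)%:C *: x).
  apply: resolvent_bound; apply: gap.
  by rewrite addrC addKr normrN ger0_norm // ltW.
(* The estimates below end in (c1 c2)^2 |x|^2 <= (c2 + m)^2 (2 m + 1) t |x|^2. With t <= q this
   leaves t |x|^2 <= 0; the added 1 in the denominator provides that contradiction. *)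
pose q := (c1 * c2) ^+ 2 / ((c2 + m) ^+ 2 * (2 * m + 1) + 1).
have den0 : 0 < (c2 + m) ^+ 2 * (2 * m + 1) + 1.
  by rewrite ltr_wpDl // mulr_ge0 ?exprn_ge0 //; lra.
have q0 : 0 < q by rewrite divr_gt0 // exprn_gt0 // mulr_gt0.
pose t := Num.min 1 q.
have t0 : 0 < t by rewrite lt_min ltr01.
have t1 : t <= 1 by rewrite ge_min lexx.
have tq : t * ((c2 + m) ^+ 2 * (2 * m + 1) + 1) <= (c1 * c2) ^+ 2.
  by rewrite -ler_pdivlMr // ge_min lexx orbT.
have [x [y [Axy xy]]] : exists x y, A (x, y) /\
    nrm (y - l%:C *: x) < (m + t) * nrm x.
  apply: contrapT => nxy; suff /(ub_le_sup (proj2 sS)) : S (m + t).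
    by rewrite -/m gerDl leNgt t0.
  move=> x y Axy; rewrite leNgt; apply/negP => h.
  by apply: nxy; exists x, y.
have xp : 0 < nrm x.
  rewrite lt_neqAle nrm_ge0 andbT; apply/eqP => e.
  by move: xy; rewrite -e mulr0 ltNge nrm_ge0.
have [/(_ x)[w [Aw _]] _] : resolvent_set A l%:C by apply: gap; rewrite subrr normr0.
set u := y - l%:C *: x in xy.
have mw : m * nrm w <= nrm x by have := Sm _ _ Aw; rewrite addrK.
have uw : dot u w = (nrm x ^+ 2)%:C.
  have := self_adjoint_sym Aw Axy; rewrite /u dotBl dotZl conjc_real => ->.
  by rewrite dotDr dotZr addrK dot_nrm.
have v1 : c1 * nrm (x + m%:C *: w) <= nrm (u - (m ^+ 2)%:C *: w).
  have := S1 _ _ (self_adjointD Axy (self_adjointZ m%:C Aw)).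
  by rewrite rmorphD /= shifted_difference_of_squares rmorphXn.
have v2 : c2 * nrm w <= nrm (x + m%:C *: w).
  have := S2 _ _ Aw; congr (_ <= nrm _).
  by rewrite rmorphB scalerBl opprB -addrA subrKC.
clearbody t m u.
(* Expanding the square with <u, w> = |x|^2, |u| <= (m + t) |x| and m |w| <= |x| leaves ((m + t)^2 -
   m^2) |x|^2, and t^2 <= t. *)
have sq : nrm (u - (m ^+ 2)%:C *: w) ^+ 2 <= t * (2 * m + 1) * nrm x ^+ 2.
  rewrite nrm_sqrB dotZr uw -rmorphM /= nrmZ nrm_real ger0_norm ?exprn_ge0 ?(ltW m0) //.
  have : nrm u ^+ 2 <= ((m + t) * nrm x) ^+ 2.
    by rewrite ler_sqr ?nnegrE ?(ltW xy) ?nrm_ge0 // mulr_ge0 ?nrm_ge0 // ltW // addr_gt0.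
  have : (m * nrm w) ^+ 2 <= nrm x ^+ 2.
    by rewrite ler_sqr ?nnegrE ?nrm_ge0 // mulr_ge0 ?nrm_ge0 // ltW.
  move/(ler_wpM2l (exprn_ge0 2 (ltW m0))) => h1 h2.
  have : t ^+ 2 * nrm x ^+ 2 <= t * nrm x ^+ 2.
    by rewrite ler_wpM2r ?exprn_ge0 ?nrm_ge0 // expr2 ler_piMr // ltW.
  move: h1 h2; rewrite !exprMn. lra.
have xv : c2 * nrm x <= (c2 + m) * nrm (x + m%:C *: w).
  have := nrmB (x + m%:C *: w) (m%:C *: w).
  rewrite addrK nrmZ nrm_real (ger0_norm (ltW m0)).
  move/(ler_wpM2l (ltW c20)); have := ler_wpM2l (ltW m0) v2; lra.
have : c1 * c2 * nrm x <= (c2 + m) * nrm (u - (m ^+ 2)%:C *: w).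
  have := ler_wpM2l (ltW c10) xv.
  have := ler_wpM2l (ltW (addr_gt0 c20 m0)) v1; lra.
have c12 := mulr_gt0 c10 c20.
rewrite -ler_sqr ?nnegrE ?mulr_ge0 ?nrm_ge0 ?(ltW c10) ?(ltW c20) ?(ltW c12) ?(ltW (addr_gt0 c20 m0)) //.
rewrite ![(_ * nrm _) ^+ 2]exprMn => h.
have := ler_wpM2l (exprn_ge0 2 (ltW (addr_gt0 c20 m0))) sq.
have := ler_wpM2r (exprn_ge0 2 (ltW xp)) tq.
have := mulr_gt0 t0 (exprn_gt0 2 xp).
by move: h; lra.
Qed.

End SelfAdjoint.

(** * Isolated spectral points and the sufficient half of Weyl's criterion *)

Section EssentialSpectrum.
Context {R : realType} {X : hilbertType R} {A : set (X * X)}.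
Hypothesis hA : self_adjoint A.
Local Notation C := R[i].

Section IsolatedPoint.
Variables (l d : R).
Hypothesis d0 : 0 < d.
Hypothesis iso : forall l' : R, l' != l -> `|l' - l| < d -> resolvent_set A l'%:C.

(** The balls of radius d / 2 around l + d / 2 and l - d / 2 avoid [l] and lie in the resolvent set,
    so [resolvent_gap] applies at both centres. When |z - s x|^2 >= (d / 2)^2 |x|^2 is expanded for
    s = d / 2 and s = - d / 2, the terms in |x|^2 cancel. *)
Lemma isolated_form_bound x y : A (x, y) ->
  d * `|complex.Re (dot x (y - l%:C *: x))| <= nrm (y - l%:C *: x) ^+ 2.
Proof.
move=> Axy; set z := y - l%:C *: x.
have half s : `|s| = d / 2 -> 2 * s * complex.Re (dot x z) <= nrm z ^+ 2.
  move=> sd; have gap l' : `|l' - (l + s)| < d / 2 -> resolvent_set A l'%:C.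
    rewrite -sd => l's; apply: iso.
      by apply: contraTneq l's => ->; rewrite opprD addNKr normrN ltxx.
    have -> : l' - l = l' - (l + s) + s by rewrite opprD addrA subrK.
    apply: le_lt_trans (ler_normD _ _) _; rewrite (splitr d) -sd ltrD2r //.
  have := resolvent_gap hA gap Axy.
  rewrite rmorphD scalerDl opprD addrA -/z => h.
  have : (d / 2 * nrm x) ^+ 2 <= nrm (z - s%:C *: x) ^+ 2.
    by rewrite ler_sqr ?nnegrE ?nrm_ge0 // -sd mulr_ge0 ?nrm_ge0.
  rewrite nrm_sqrB nrmZ nrm_real -sd dotZr.
  have -> : complex.Re (s%:C * dot z x) = s * complex.Re (dot x z).
    by rewrite [dot z x]dotC; case: (dot x z) => a b /=; rewrite mul0r subr0.
  lra.
have d2 : 0 <= d / 2 by rewrite divr_ge0 ?ltW.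
have := half (d / 2); have := half (- (d / 2)).
rewrite normrN (ger0_norm d2) => /(_ erefl) h1 /(_ erefl) h2.
by case: (ler0P (complex.Re _)) => _; lra.
Qed.

(* The form [x, x' |-> dot x ((A - l) x')] is dominated by the square of
   [nrm ((A - l) x)] on the diagonal, hence, by polarization, everywhere. *)
Lemma isolated_form_polarized x y x' y' : A (x, y) -> A (x', y') ->
  d * complex.Re (dot x (y' - l%:C *: x')) <=
  nrm (y - l%:C *: x) * nrm (y' - l%:C *: x').
Proof.
have sym u v u' v' : A (u, v) -> A (u', v') ->
    dot u' (v - l%:C *: u) = (dot u (v' - l%:C *: u'))^*%C.
  move=> Auv Auv'; rewrite -dotC dotBl dotBr dotZl dotZr conjc_real.
  by rewrite (self_adjoint_sym hA Auv Auv').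
have main u v u' v' : A (u, v) -> A (u', v') ->
    2 * d * complex.Re (dot u (v' - l%:C *: u')) <=
    nrm (v - l%:C *: u) ^+ 2 + nrm (v' - l%:C *: u') ^+ 2.
  move=> Auv Auv'; have := sym _ _ _ _ Auv Auv'.
  have := isolated_form_bound (self_adjointD hA Auv Auv').
  have := isolated_form_bound (self_adjointB hA Auv Auv').
  rewrite !scalerBr !scalerDr.
  have -> : v - v' - (l%:C *: u - l%:C *: u') = (v - l%:C *: u) - (v' - l%:C *: u').
    by rewrite !opprD !opprK addrACA.
  have -> : v + v' - (l%:C *: u + l%:C *: u') = (v - l%:C *: u) + (v' - l%:C *: u').
    by rewrite opprD addrACA.
  move: (v - _ *: u) (v' - _ *: u') => w w'.
  have := parallelogram w w'.
  rewrite dotBl dotDl !dotBr !dotDr => par hm hp e; move: hm hp; rewrite e.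
  case: (dot u w) (dot u w') (dot u' w') => a a' [b b'] [c c'] /= hm hp.
  have := ler_wpM2l (ltW d0) (ler_norm (a + b + (b + c))).
  have := ler_wpM2l (ltW d0) (ler_norm (- (a - b - (b - c)))).
  rewrite normrN; lra.
move=> Axy Axy'; set z := y - _ *: x; set z' := y' - _ *: x'.
have [z0|z0] := eqVneq z 0.
  by rewrite -[dot x z']conjcK -(sym _ _ _ _ Axy Axy') -/z z0 dot0r nrm0 mul0r conjc0 /= mulr0.
have [z'0|z'0] := eqVneq z' 0; first by rewrite z'0 dot0r nrm0 /= !mulr0.
have nz := nrm_gt0 z0; have nz' := nrm_gt0 z'0.
(* Scaling [x] by |z'| and [x'] by |z| equalizes the two squares, which turns their sum into twice
   the product of the norms. *)
have := main _ _ _ _ (self_adjointZ hA (nrm z')%:C Axy) (self_adjointZ hA (nrm z)%:C Axy').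
rewrite !scalerA ![l%:C * _]mulrC -!scalerA -!scalerBr -/z -/z'.
rewrite !nrmZ !nrm_real !ger0_norm ?nrm_ge0 // dotZr dotZl conjc_real mulrA -rmorphM /=.
have -> : complex.Re ((nrm z * nrm z')%:C * dot x z') = nrm z * nrm z' * complex.Re (dot x z').
  by case: (dot x z') => a b /=; rewrite mul0r subr0.
move=> h; rewrite -(ler_pM2l (mulr_gt0 nz nz')); lra.
Qed.

(** With [a] the projection of [x] on the closed range of A - l, x - a is orthogonal to the range,
    hence an eigenvector. Approximating [a] by vectors of the range in [isolated_form_polarized]
    gives d |a|^2 = d Re <x, a> <= |z| |a|. *)
Lemma near_eigenspace x y : A (x, y) ->
  exists2 b, A (b, l%:C *: b) & d * nrm (x - b) <= nrm (y - l%:C *: x).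
Proof.
move=> Axy; set z := y - _ *: x.
pose rg := [set u | exists2 v, A (v, u + l%:C *: v) & True].
have hrg : is_subspace rg.
  split.
    by exists 0 => //; rewrite scaler0 addr0; exact: (subspace0 (self_adjoint_subspace hA)).
  move=> c u w [v Av _] [t At _]; exists (c *: v + t) => //.
  have := self_adjointD hA (self_adjointZ hA c Av) At.
  by rewrite !scalerDr addrACA !scalerA (mulrC c).
have [a cla orth] := projection x (closure_subspace hrg) (@closed_closure _ rg).
exists (x - a).
  apply: (self_adjoint_max hA) => u v Auv.
  have : dot (v - l%:C *: u) (x - a) = 0.
    by apply: orth; apply: subset_closure; exists u; rewrite ?subrK.
  by rewrite dotBl dotZl conjc_real dotZr => /eqP; rewrite subr_eq0 => /eqP.
rewrite subKr.
have xa : dot x a = (nrm a ^+ 2)%:C.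
  have := orth a cla; rewrite dotBr dot_nrm => /eqP; rewrite subr_eq0 => /eqP e.
  by rewrite dotC e conjc_real.
have : d * nrm a ^+ 2 <= nrm z * nrm a.
  apply/ler_addgt0Pr => e e0.
  pose q := e / (nrm z + d * nrm x + 1).
  have den0 : 0 < nrm z + d * nrm x + 1.
    by rewrite ltr_wpDl // addr_ge0 ?mulr_ge0 ?nrm_ge0 ?(ltW d0).
  have q0 : 0 < q by rewrite divr_gt0.
  have qe : q * (nrm z + d * nrm x + 1) = e by rewrite divfK // gt_eqF.
  move/closureP : cla => /(_ _ q0)[u [v Av _] au].
  have := isolated_form_polarized Axy Av; rewrite addrK -/z => h.
  have := Re_le_nrm (dot x (a - u)).
  have := cauchy_schwarz x (a - u).
  have := ler_wpM2l (nrm_ge0 x) (ltW au).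
  rewrite dotBr xa raddfB /= => h1 h2 h6.
  have := nrm_triangle a u 0; rewrite !subr0 (nrmBC u a) => h3.
  have := ler_wpM2l (nrm_ge0 z) (le_trans h3 (lerD (ltW au) (lexx _))) => h4.
  have h5 := le_trans h6 (le_trans h2 h1).
  have := ler_wpM2l (ltW d0) h5.
  move: h h4 q0 qe; lra.
have [->|a0] := eqVneq a 0; first by move=> _; rewrite nrm0 mulr0 nrm_ge0.
by rewrite expr2 mulrA ler_pM2r // nrm_gt0.
Qed.

End IsolatedPoint.

(** If [E] were discrete, [x] would be close to an eigenvector [b], while [b], reproduced by a
    finite list almost orthogonal to [x], would be small. Testing against finite lists replaces weak
    convergence; the bound 1 / 2 suits vectors whose norms merely tend to 1. *)
Lemma ess_spectrum_of_approximation (E : R) :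
  (forall e : R, 0 < e -> forall s : seq X, exists x y,
     [/\ A (x, y), 1 / 2 <= nrm x, nrm (y - E%:C *: x) <= e &
         forall f, f \in s -> nrm (dot f x) <= e]) ->
  ess_spectrum A E.
Proof.
move=> h; split.
  move=> /resolvent_bound[c c0 bc].
  have [|x [y [/bc cx x1 xe _]]] := h (c / 4) _ [::]; first by rewrite divr_gt0.
  have := ler_wpM2l (ltW c0) x1; lra.
move=> -[[_ [V /nbhs_normP[d /= d0 dV] VE]] _ [n [e eP]]].
have iso l' : l' != E -> `|l' - E| < d -> resolvent_set A l'%:C.
  move=> l'E l'd; apply: contrapT => sl'.
  have : (V `&` spectrum A) l' by split => //; apply: dV; rewrite /= distrC.
  by rewrite VE /= => e'; move: l'E; rewrite e' eqxx.
have [s [_ sP]] := gram_schmidt e.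
pose Q := \sum_(f <- s) (1 + nrm f / d) * nrm f.
have Q0 : 0 <= Q.
  by apply: sumr_ge0 => f _; rewrite mulr_ge0 ?addr_ge0 ?divr_ge0 ?nrm_ge0 ?ltW.
have Qd : 0 < Q + d^-1 by rewrite ltr_wpDl ?invr_gt0.
(* Makes |x| <= |b| + |x - b| <= eps (Q + 1 / d) = 1 / 4, against |x| >= 1 / 2. *)
pose eps := (Q + d^-1)^-1 / 4.
have eps0 : 0 < eps by rewrite divr_gt0 ?invr_gt0.
have [x [y [Axy x1 xe xs]]] := h _ eps0 s.
have [b Ab xb] := near_eigenspace d0 iso Axy.
have xb' : nrm (x - b) <= eps / d by rewrite ler_pdivlMr // mulrC (le_trans xb).
have bE := sP b (eP _ Ab).
have : nrm b <= eps * Q.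
  rewrite {1}bE; apply: le_trans (ler_nrm_sum _ _ _) _.
  rewrite mulr_sumr big_seq [leRHS]big_seq; apply: ler_sum => f fs.
  rewrite nrmZ mulrA ler_wpM2r ?nrm_ge0 //.
  have -> : b = x - (x - b) by rewrite subKr.
  rewrite dotBr; apply: le_trans (nrmB _ _) _.
  rewrite mulrDr mulr1 lerD ?xs //; apply: le_trans (cauchy_schwarz _ _) _.
  by rewrite mulrCA ler_wpM2l ?nrm_ge0.
have := nrm_triangle b x 0; rewrite !subr0.
have : eps * (Q + d^-1) = 1 / 4 by rewrite /eps mulrAC mulVf ?gt_eqF.
move: xb'; clearbody eps Q; lra.
Qed.

End EssentialSpectrum.

(** * The necessary half of Weyl's criterion, and the bottom of the spectrum *)

Section WeylSequence.
Context {R : realType} {X : hilbertType R} {A : set (X * X)}.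
Hypothesis hA : self_adjoint A.
Local Notation C := R[i].

Lemma eigenspace_subspace (l : R) : is_subspace (Defs.eigenspace A l).
Proof.
split; first by rewrite /Defs.eigenspace /= scaler0; exact: (subspace0 (self_adjoint_subspace hA)).
move=> a x y Ax Ay; rewrite /Defs.eigenspace /= scalerDr scalerA mulrC -scalerA.
exact: (self_adjointD hA (self_adjointZ hA a Ax) Ay).
Qed.

(** The graph of A - l on the orthogonal complement of the eigenspace at [l]: its kernel is trivial,
    as [bounded_below_extend] requires. *)
Definition shifted_graph (l : R) : set (X * X) :=
  [set p | A (p.1, p.2 + l%:C *: p.1) /\
           forall n, Defs.eigenspace A l n -> dot n p.1 = 0].

Lemma shift_bounded (l : R) :
  linear (fun p : X * X => (p.1, p.2 + l%:C *: p.1)) /\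
  forall p : X * X, nrm (p.1, p.2 + l%:C *: p.1) <= (2 + `|l|) * nrm p.
Proof.
split=> [a [x y] [u v] /=|[x y] /=].
  congr pair => /=; rewrite !scalerDr addrACA !scalerA.
  by congr (_ + (_ + _)); rewrite mulrC.
apply: le_trans (nrm_pair_le _) _ => /=.
apply: le_trans (lerD (lexx _) (nrmD _ _)) _; rewrite nrmZ nrm_real.
have := nrm_fst (x, y); have := nrm_snd (x, y) => /= h1 h2.
have := ler_wpM2l (normr_ge0 l) h2; lra.
Qed.

Lemma shifted_graph_closed (l : R) :
  is_subspace (shifted_graph l) /\ closed (shifted_graph l).
Proof.
have [lf bf] := shift_bounded l.
have [hs cs] := bounded_preimage lf bf (self_adjoint_subspace hA) (self_adjoint_closed hA).
have orth n : is_subspace [set p : X * X | dot n p.1 = 0] /\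
    closed [set p : X * X | dot n p.1 = 0].
  apply: (@bounded_kernel _ _ _ id (fun p : X * X => dot n p.1) (nrm n)).
    by move=> a x y /=; rewrite dotDr dotZr.
  move=> p; apply: le_trans (cauchy_schwarz _ _) _.
  by rewrite ler_wpM2l ?nrm_ge0 ?nrm_fst.
split.
  split; first by split=> [|n Nn]; [exact: (subspace0 hs)|exact: (subspace0 (orth n).1)].
  move=> a p q [Ap Np] [Aq Nq]; split; first exact: (proj2 hs).
  by move=> n Nn; apply: (proj2 (orth n).1); [exact: Np|exact: Nq].
apply/closed_nrmP => p clp; split.
  by apply: ((closed_nrmP _).1 cs p) => e /clp[q [Aq _] pq]; exists q.
move=> n Nn; apply: ((closed_nrmP _).1 (orth n).2 p) => e /clp[q [_ Nq] pq].
by exists q => //; exact: Nq.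
Qed.

(** [bounded_below_extend] removes the conditions from [s] and leaves a bound [c] on the complement
    of the eigenspace. For 0 < |l - m| < c, A - m is bounded below on both orthogonal parts, so [l]
    is isolated. A trivial eigenspace would put [l] in the resolvent set, and since [s] separates
    the eigenspace, its dimension is finite. *)
Lemma discrete_of_bounded_below (l e : R) (s : seq X) :
  0 < e -> spectrum A l ->
  (forall x y, A (x, y) -> (forall f, f \in s -> dot f x = 0) ->
     e * nrm x <= nrm (y - l%:C *: x)) ->
  discrete_spectrum A l.
Proof.
move=> e0 sl be.
have hN := eigenspace_subspace l.
have cN : closed (Defs.eigenspace A l).
  have lf : linear (fun x : X => (x, l%:C *: x)).
    move=> a x y; congr pair => /=.
    by rewrite scalerDr !scalerA mulrC.
  have bf (x : X) : nrm (x, l%:C *: x) <= (1 + `|l|) * nrm x.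
    apply: le_trans (nrm_pair_le _) _ => /=; rewrite nrmZ nrm_real; lra.
  exact: (bounded_preimage lf bf (self_adjoint_subspace hA) (self_adjoint_closed hA)).2.
have [hG cG] := shifted_graph_closed l.
have [x [+ Nx]|x z [/= Ax Nx] xs|c c0 cP] :=
    @bounded_below_extend _ _ s (shifted_graph l) e hG cG _ e0.
- by rewrite /= add0r => Ax; apply: dot_eq0; exact: Nx.
- by have := be _ _ Ax xs; rewrite addrK.
split.
- split; first exact/mem_set.
  exists [set x | `|l - x| < c].
    by apply/nbhs_normP; exists c.
  apply/seteqP; split=> [m [/= lm sm]|_ ->]; last first.
    by split => //=; rewrite subrr normr0.
  apply: contrapT => ml; apply: sm.
  have ml0 : 0 < `|l - m|.
    by rewrite normr_gt0 subr_eq0; apply/eqP => e'; apply: ml.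
  have cm : 0 < c - `|l - m| by rewrite subr_gt0.
  (* The first summand controls the component orthogonal to the eigenspace, the second the component
     inside it. *)
  apply: (@resolvent_of_bound _ _ _ hA m ((c - `|l - m|)^-1 + `|l - m|^-1)).
  move=> x y Axy.
  have [n Nn orth] := projection x hN cN.
  pose x' := x - n.
  have Gx' : shifted_graph l (x', y - l%:C *: x).
    split; last exact: orth.
    rewrite /= /x' scalerBr addrA subrK; exact: (self_adjointB hA).
  pose w := (y - l%:C *: x) + (l - m)%:C *: x'.
  have nw : dot w ((l - m)%:C *: n) = 0.
    rewrite dotZr dotC dotDr dotZr [dot n x']orth // mulr0 addr0 dotBr dotZr.
    have -> : dot n y = l%:C * dot n x.
      by rewrite -(self_adjoint_sym hA Axy Nn) dotZl conjc_real.
    by rewrite subrr conjc0 mulr0.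
  have yE : y - m%:C *: x = w + (l - m)%:C *: n.
    rewrite /w -addrA -scalerDr subrK rmorphB scalerBl addrA subrK //.
  have := pythagoras nw; rewrite -yE nrmZ nrm_real => py.
  have w1 : nrm w <= nrm (y - m%:C *: x).
    by rewrite -ler_sqr ?nnegrE ?nrm_ge0 // py lerDl exprn_ge0 // mulr_ge0 ?nrm_ge0.
  have n1 : `|l - m| * nrm n <= nrm (y - m%:C *: x).
    by rewrite -ler_sqr ?nnegrE ?nrm_ge0 ?mulr_ge0 ?nrm_ge0 // py lerDr exprn_ge0 // nrm_ge0.
  have w2 : (c - `|l - m|) * nrm x' <= nrm w.
    have := cP _ _ Gx'; have := nrmB w ((l - m)%:C *: x').
    rewrite {1}/w addrK nrmZ nrm_real; lra.
  have -> : x = x' + n by rewrite subrK.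
  apply: le_trans (nrmD _ _) _.
  rewrite subrK mulrDl lerD // mulrC ler_pdivlMr // mulrC //.
  exact: le_trans w1.
- apply: contrapT => ne; apply: sl.
  apply: (@resolvent_of_bound _ _ _ hA l c^-1) => x y Axy.
  rewrite mulrC ler_pdivlMr // mulrC; apply: cP; split; first by rewrite /= subrK.
  move=> n Nn; have [->|n0] := eqVneq n 0; first by rewrite dot0l.
  by case: ne; exists n.
apply: (@finite_dim_of_separating _ _ s) => // x Nx xs.
have := be _ _ Nx xs; rewrite subrr nrm0 pmulr_rle0 // => x0.
by apply: nrm0_eq0; apply/eqP; rewrite eq_le x0 nrm_ge0.
Qed.

(** Were there no almost eigenvector orthogonal to some finite list, [discrete_of_bounded_below]
    would make [l] discrete; so the sequence can be continued forever. *)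
Lemma weyl_sequence (l : R) : ess_spectrum A l ->
  exists h : nat -> X, exists g : nat -> X,
    [/\ forall n, A (h n, g n), forall n, nrm (h n) = 1,
        forall i j, (i < j)%N -> dot (h i) (h j) = 0 &
        forall n, nrm (g n - l%:C *: h n) < n.+1%:R^-1].
Proof.
move=> [sl nd].
have /choice[nx nxP] : forall s : seq X, exists p : X * X,
    [/\ A p, nrm p.1 = 1, forall f, f \in s -> dot f p.1 = 0 &
        nrm (p.2 - l%:C *: p.1) < (size s).+1%:R^-1].
  move=> s; apply: contra_notP nd => ns.
  have e0 : 0 < (size s).+1%:R^-1 :> R by rewrite invr_gt0.
  apply: (discrete_of_bounded_below e0 sl (s := s)) => x y Axy xs.
  rewrite leNgt; apply/negP => xy.
  have x0 : 0 < nrm x.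
    rewrite lt_neqAle nrm_ge0 andbT; apply/eqP => x0.
    by move: xy; rewrite -x0 mulr0 ltNge nrm_ge0.
  have nr : nrm ((nrm x)^-1%:C : C) = (nrm x)^-1.
    by rewrite nrm_real ger0_norm // invr_ge0 ltW.
  apply: ns; exists ((nrm x)^-1%:C *: x, (nrm x)^-1%:C *: y); split => /=.
  - exact: self_adjointZ.
  - by rewrite nrmZ nr mulVf // gt_eqF.
  - by move=> f fs; rewrite dotZr xs // mulr0.
  by rewrite scalerA mulrC -scalerA -scalerBr nrmZ nr mulrC ltr_pdivrMr.
(* [S n] lists the first n vectors chosen; its length n is what turns the error of the next one into
   1 / (n + 1). *)
pose S := fix S n := if n is m.+1 then rcons (S m) (nx (S m)).1 else [::].
have sS n : size (S n) = n by elim: n => //= n IH; rewrite size_rcons IH.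
have mS i j : (i < j)%N -> (nx (S i)).1 \in S j.
  elim: j => // j IH; rewrite ltnS leq_eqVlt => /orP[/eqP->|/IH h] /=.
    by rewrite mem_rcons inE eqxx.
  by rewrite mem_rcons inE h orbT.
exists (fun n => (nx (S n)).1), (fun n => (nx (S n)).2); split.
- by move=> n; have [] := nxP (S n); case: (nx _).
- by move=> n; have [] := nxP (S n).
- by move=> i j /mS h; have [_ _ /(_ _ h)] := nxP (S j).
by move=> n; have [_ _ _] := nxP (S n); rewrite sS.
Qed.

(** With an empty spectrum [resolvent_gap] would hold at 0 for every [d], hence d |u| <= |A u| for
    arbitrarily large [d] at a nonzero [u] of the domain. *)
Lemma spectrum_nonempty : (exists x : X, x != 0) -> spectrum A !=set0.
Proof.
move=> [x x0]; apply: contrapT => ns.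
have all l : resolvent_set A l%:C by apply: contrapT => sl; apply: ns; exists l.
have dA : dense (dom A) := proj2 (proj1 hA).
have op : open [set u | nrm (x - u) < nrm x / 2].
  rewrite openE => u /= xu; apply/nbhs_nrmP.
  exists (nrm x / 2 - nrm (x - u)); first by rewrite subr_gt0.
  move=> v uv /=; have := nrm_triangle u x v; lra.
have nx := nrm_gt0 x0.
have [|u [/= xu [v Auv]]] := dA _ _ op.
  by exists x => /=; rewrite subrr nrm0 divr_gt0.
have u0 : 0 < nrm u.
  have := nrm_triangle u x 0; rewrite !subr0; lra.
have := @resolvent_gap _ _ _ hA 0 ((nrm v + 1) / nrm u) (fun l _ => all l) u v Auv.
rewrite divfK ?gt_eqF // scale0r subr0; lra.
Qed.

Lemma spectrum_lbound : bounded_below A -> has_lbound (spectrum A).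
Proof.
move=> [c bc]; exists c => l sl; rewrite leNgt; apply/negP => lc; apply: sl.
apply: (@resolvent_of_bound _ _ _ hA l (c - l)^-1) => x y Axy.
have lc' : 0 < c - l by rewrite subr_gt0.
have [->|x0] := eqVneq x 0; first by rewrite nrm0 mulr_ge0 ?nrm_ge0 // invr_ge0 ltW.
have nx := nrm_gt0 x0.
rewrite mulrC ler_pdivlMr // -(ler_pM2l nx).
have := bc _ _ Axy; rewrite nrmE -rmorphXn -rmorphM /= lecE /= => /andP[_ h].
apply: le_trans (cauchy_schwarz x (y - l%:C *: x)).
apply: le_trans (Re_le_nrm _).
rewrite dotBr dotZr dot_nrm -rmorphM raddfB /=; move: h; lra.
Qed.

End WeylSequence.

(** * Wedge products and the anticommutation relations *)

(** Laplace expansion along the first row, then the first column. For the Gram matrix of two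
    families with [h] put in front, the corner term carries |h|^2 and the double sum is the
    annihilation term of the anticommutation relation. *)
Lemma det_bordered (K : comNzRingType) n (B : 'M[K]_n.+2) :
  \det B = B 0 0 * \det (row' 0 (col' 0 B)) -
    \sum_(i < n.+1) \sum_(j < n.+1) (-1) ^+ (i + j) * B (lift 0 i) 0 * B 0 (lift 0 j) *
      \det (row' i (col' j (row' 0 (col' 0 B)))).
Proof.
rewrite (expand_det_row B 0) big_ord_recl /cofactor /= expr0 mul1r; congr (_ + _).
rewrite exchange_big -sumrN; apply: eq_bigr => j _ /=.
rewrite (expand_det_col _ 0) !mulr_sumr -sumrN; apply: eq_bigr => i _.
rewrite /cofactor !mxE /= addn0 add0n.
have -> : lift (lift 0 j) 0 = 0 :> 'I_n.+2 by apply: val_inj.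
have -> : row' i (col' 0 (row' 0 (col' (lift 0 j) B))) =
          row' i (col' j (row' 0 (col' 0 B))).
  apply/matrixP => a b; rewrite !mxE; congr (B _ _).
  by apply: val_inj; rewrite /= /bump /= !add1n ltnS; case: leqP.
by rewrite /bump add1n exprD exprS; ring.
Qed.

Section Wedge.
Context {R : realType} {X : hilbertType R} (F : fermion_fock X).
Local Notation C := R[i].

Lemma conjc_sign n : ((-1) ^+ n : C)^*%C = (-1) ^+ n.
Proof.
elim: n => [|n IH]; first by rewrite expr0 conjc1.
rewrite exprS conjcM IH; congr (_ * _).
by apply/eqP; rewrite eq_complex /= !oppr0 !eqxx.
Qed.

(** The summand for a pair of permutations depends only on their quotient; one of the two sums then
    merely counts, and its n! cancels one normalization factor. *)
Lemma dot_antisymmetrize n (T : tensor_power X n) (f g : 'I_n -> X) :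
  dot (antisymmetrize T f) (antisymmetrize T g) =
  (n`!%:R)^-1 * \det (\matrix_(i, j) dot (f i) (g j)).
Proof.
rewrite /antisymmetrize dotZl dotZr dot_suml.
have fact0 : n`!%:R != 0 :> C by rewrite pnatr_eq0 -lt0n fact_gt0.
have -> : ((n`!%:R)^-1 : C)^*%C = (n`!%:R)^-1.
  by rewrite -(rmorph_nat (real_complex R)) -fmorphV conjc_real.
congr (_ * _); under eq_bigr => s _.
  rewrite dotZl dot_sumr mulr_sumr (reindex_inj (mulgI s)) /=.
  under eq_bigr => t _.
    rewrite dotZr dot_tpow odd_permM signr_addb conjc_sign.
    rewrite !mulrA -signr_addb addbb expr0 mul1r.
    rewrite [X in _ * X](_ : _ = \prod_i dot (f i) (g (t i))); last first.
      rewrite [RHS](reindex_inj (@perm_inj _ s)) /=.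
      by apply: eq_bigr => i _; rewrite permM.
    over.
  over.
rewrite sumr_const card_Sn -[X in _ * X]mulr_natl mulKf //.
by apply: eq_bigr => t _; congr (_ * _); apply: eq_bigr => i _; rewrite mxE.
Qed.

Lemma antisymmetrize_antisymmetric n (f : 'I_n -> X) :
  antisymmetric_power (antisymmetrize (fock_power F n) f).
Proof. by apply/subset_closure/sub_linspan; exists f. Qed.

Lemma dot_wedge n (f g : 'I_n -> X) :
  dot (wedge F f) (wedge F g) = (n`!%:R)^-1 * \det (\matrix_(i, j) dot (f i) (g j)).
Proof.
by rewrite dot_summand ?dot_antisymmetrize //; exact: antisymmetrize_antisymmetric.
Qed.

Lemma dot_wedge_neq n m (f : 'I_n -> X) (g : 'I_m -> X) : n <> m ->
  dot (wedge F f) (wedge F g) = 0.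
Proof.
by move=> nm; apply: summand_orthogonal => //; exact: antisymmetrize_antisymmetric.
Qed.

Lemma fcons0 (x : X) n (f : 'I_n -> X) : fcons x f ord0 = x.
Proof. by rewrite /fcons unlift_none. Qed.

Lemma fconsS (x : X) n (f : 'I_n -> X) i : fcons x f (lift ord0 i) = f i.
Proof. by rewrite /fcons liftK. Qed.

(** The coefficients are cofactors of the column of [x], so they do not depend on [x] and may be
    formed at [x = 0]. Linearity and weak limits in [x] both follow from this. *)
Lemma dot_wedge_fcons n (v : 'I_n.+1 -> X) (f : 'I_n -> X) :
  exists c : 'I_n.+1 -> C, forall x,
    dot (wedge F v) (wedge F (fcons x f)) = \sum_i c i * dot (v i) x.
Proof.
pose N x := \matrix_(i, j) dot (v i) (fcons x f j).
exists (fun i => (n.+1`!%:R)^-1 * cofactor (N 0) i 0) => x.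
rewrite dot_wedge (expand_det_col _ 0) mulr_sumr; apply: eq_bigr => i _.
have -> : cofactor (N 0) i 0 = cofactor (N x) i 0.
  by rewrite /cofactor; congr (_ * \det _); apply/matrixP => a b; rewrite !mxE !fconsS.
by rewrite mxE fcons0 -mulrA [X in _ * X]mulrC.
Qed.

(** The defect of linearity is a combination of wedges and, by [dot_wedge_fcons], orthogonal to
    every wedge; so it is orthogonal to itself. *)
Lemma wedge_fcons_linear n (f : 'I_n -> X) : linear (fun x => wedge F (fcons x f)).
Proof.
move=> a x y; apply/eqP; rewrite -subr_eq0; apply/eqP.
set u := (u in u = 0).
have orth (v : 'I_n.+1 -> X) : dot (wedge F v) u = 0.
  have [c cE] := dot_wedge_fcons v f.
  rewrite /u dotBr dotDr dotZr !cE mulr_sumr -big_split -sumrB big1 // => i _ /=.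
  by rewrite dotDr dotZr; ring.
by apply: dot_eq0; rewrite {1}/u dotBl dotDl dotZl !orth mulr0 addr0 subr0.
Qed.

Definition cre (h : X) n (f : 'I_n -> X) : F :=
  (Num.sqrt (n.+1%:R : R))%:C *: wedge F (fcons h f).

(** The usual action of B(h) on a wedge. The factor n^(-1/2) comes from the normalization of
    [wedge]; for n = 0 the sum is empty. *)
Definition ann (h : X) n (f : 'I_n -> X) : F :=
  \sum_(j < n) ((Num.sqrt (n%:R : R))^-1%:C * ((-1) ^+ j * dot h (f j))) *:
    wedge F (f \o lift j).

Lemma sqrt_natr_sqr n : (Num.sqrt (n%:R : R))%:C * (Num.sqrt (n%:R : R))%:C = n%:R :> C.
Proof. by rewrite -rmorphM -expr2 sqr_sqrtr ?ler0n // rmorph_nat. Qed.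

(** The relation {B(h), B*(h)} = |h|^2 as an identity of inner products. For equal degrees, the
    factor n + 1 from the two square roots reduces the (n + 1)! of the larger Gram determinant to
    n!, and [det_bordered] does the rest. *)
Lemma canonical_anticommutation n m (h : X) (f : 'I_n -> X) (g : 'I_m -> X) :
  dot (cre h f) (cre h g) + dot (ann h f) (ann h g) =
  dot h h * dot (wedge F f) (wedge F g).
Proof.
have [nm|nm] := eqVneq n m; last first.
  rewrite (dot_wedge_neq _ _ (elimN eqP nm)) mulr0 /cre dotZl dotZr dot_wedge_neq; last first.
    by move=> [e]; rewrite e eqxx in nm.
  rewrite !mulr0 add0r /ann dot_suml big1 // => i _; rewrite dot_sumr big1 // => j _.
  rewrite dotZl dotZr dot_wedge_neq ?mulr0 //.
  case: n m i j {f g} nm => [|n] [|m] i j; [by case: i|by case: i|by case: j|].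
  by move=> /eqP nm /= e; apply: nm; rewrite e.
subst m; rewrite /cre dotZl dotZr conjc_real mulrA sqrt_natr_sqr !dot_wedge.
have f0 k : k`!%:R != 0 :> C by rewrite pnatr_eq0 -lt0n fact_gt0.
have n0 k : k.+1%:R != 0 :> C by rewrite pnatr_eq0.
rewrite factS natrM invfM mulrA mulVKf //.
case: n f g => [|n] f g.
  by rewrite /ann !big_ord0 dot0l addr0 !det_mx00 det_mx11 mxE !fcons0 mulr1 mulrC.
rewrite det_bordered mxE !fcons0 mulrBr.
set M := row' 0 (col' 0 _).
have ME : M = \matrix_(i, j) dot (f i) (g j).
  by apply/matrixP => i j; rewrite !mxE !fconsS.
rewrite -ME mulrCA -addrA [X in _ + X](_ : _ = 0) ?addr0 //.
apply/eqP; rewrite addrC subr_eq0; apply/eqP.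
rewrite /ann dot_suml mulr_sumr; apply: eq_bigr => i _.
rewrite dot_sumr mulr_sumr; apply: eq_bigr => j _.
rewrite dotZl dotZr dot_wedge !mxE !fcons0 !fconsS !conjcM conjc_real conjc_sign -dotC.
have -> : \matrix_(i0, j0) dot ((f \o lift i) i0) ((g \o lift j) j0) = row' i (col' j M).
  by rewrite ME; apply/matrixP => a b; rewrite !mxE.
have -> : n.+1`!%:R^-1 = (Num.sqrt (n.+1%:R : R))^-1%:C * (Num.sqrt (n.+1%:R : R))^-1%:C * n`!%:R^-1 :> C.
  by rewrite fmorphV -invfM sqrt_natr_sqr factS natrM invfM.
rewrite exprD; ring.
Qed.

Lemma nrm_ann_null n (f : 'I_n -> X) (h : nat -> X) :
  (forall k (e : R), 0 < e -> \forall m \near \oo, nrm (dot k (h m)) < e) ->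
  forall e : R, 0 < e -> \forall m \near \oo, nrm (ann (h m) f) < e.
Proof.
move=> hw e e0.
pose q := (Num.sqrt (n%:R : R))^-1.
pose Q := \sum_(j < n) `|q| * nrm (wedge F (f \o lift j)).
have Q0 : 0 <= Q by apply: sumr_ge0 => j _; rewrite mulr_ge0 ?nrm_ge0.
have eQ : 0 < e / (Q + 1) by rewrite divr_gt0 // ltr_wpDl.
have : \forall m \near \oo, forall j : 'I_n, nrm (dot (f j) (h m)) < e / (Q + 1).
  by apply: filter_forall => j; exact: hw.
apply: filterS => m hm; rewrite /ann; apply: le_lt_trans (ler_nrm_sum _ _ _) _.
apply: (@le_lt_trans _ _ (e / (Q + 1) * Q)); last first.
  by rewrite mulrAC ltr_pdivrMr ?ltr_wpDl // ltr_pM2l // ltrDl.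
rewrite {2}/Q mulr_sumr; apply: ler_sum => j _.
rewrite nrmZ !nrmM nrm_real [leRHS]mulrA ler_wpM2r ?nrm_ge0 //.
rewrite [leRHS]mulrC ler_wpM2l //.
have -> : nrm ((-1) ^+ j : C) = 1.
  by rewrite -signr_odd; case: (odd _); rewrite ?expr0 ?expr1 ?nrmN nrm1.
by rewrite mul1r nrm_dotC ltW.
Qed.

Definition dgamma n (f g : 'I_n -> X) : F :=
  \sum_(j < n) wedge F [eta f with j |-> g j].

(** In the determinant expansion, replacing row j in the term of a permutation s has the same effect
    as replacing column s j; summing over j makes the two sides agree term by term. *)
Lemma dgamma_sym n m (f f' : 'I_n -> X) (g g' : 'I_m -> X) :
  (forall i j, dot (f' i) (g j) = dot (f i) (g' j)) ->
  dot (dgamma f f') (wedge F g) = dot (wedge F f) (dgamma g g').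
Proof.
move=> sym; rewrite dot_suml dot_sumr.
have [nm|nm] := eqVneq n m; last first.
  by rewrite !big1 // => i _; rewrite dot_wedge_neq //; exact/eqP.
subst m.
under eq_bigr do rewrite dot_wedge; under [RHS]eq_bigr do rewrite dot_wedge.
rewrite -!mulr_sumr; congr (_ * _); rewrite /determinant exchange_big [RHS]exchange_big /=.
apply: eq_bigr => s _; rewrite -!mulr_sumr; congr (_ * _).
rewrite [RHS](reindex_inj (@perm_inj _ s)) /=; apply: eq_bigr => j _.
apply: eq_bigr => i _; rewrite !mxE /= (inj_eq perm_inj).
by case: eqP => // ->; exact: sym.
Qed.

(** The Leibniz rule, which is the source of the commutator of dGamma(K) with B*(x). *)
Lemma dgamma_fcons n (x x' : X) (f f' : 'I_n -> X) :
  dgamma (fcons x f) (fcons x' f') =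
  wedge F (fcons x' f) + \sum_(j < n) wedge F (fcons x [eta f with j |-> f' j]).
Proof.
rewrite /dgamma big_ord_recl; congr (wedge F _ + _).
  apply: funext => i; case: (unliftP ord0 i) => [j|] -> /=.
    by rewrite !fconsS.
  by rewrite !fcons0.
apply: eq_bigr => j _; congr (wedge F _); apply: funext => i.
case: (unliftP ord0 i) => [k|] -> /=; last by rewrite !fcons0.
by rewrite !fconsS (inj_eq lift_inj).
Qed.

Lemma wedge_total : closure (linspan [set v : F | exists n (f : 'I_n -> X), v = wedge F f]) = setT.
Proof.
set S := [set v : F | _]; have hS := linspan_subspace S.
apply/seteqP; split=> // x _.
have : closure (linspan (\bigcup_n (@summand _ _ _ F n @` antisymmetric_power (T := fock_power F n)))) x.
  by rewrite (dense_closure (@summand_total _ _ _ F)).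
apply: closure_linspan_subset; [exact: closure_subspace|exact: closed_closure|].
move=> _ [n _ [y Sy <-]].
have hP : is_subspace (antisymmetric_power (T := fock_power F n)).
  by apply: closure_subspace; exact: linspan_subspace.
have sub : linspan (range (antisymmetrize (fock_power F n))) `<=`
    [set z | antisymmetric_power z /\ linspan S (summand F z)].
  apply: linspan_subset.
    split; first split; first exact: subspace0.
      (* [summand] is linear only on antisymmetric vectors, so even [summand 0 = 0] must come from
         this law, and membership is carried along. *)
      have := @summand_linear _ _ _ F n (-1) 0 0 (subspace0 hP) (subspace0 hP).
      rewrite scaler0 addr0 scaleN1r addNr => ->; exact: subspace0.
    move=> a z w [Az Sz] [Aw Sw]; split; first exact: (proj2 hP).
    by rewrite summand_linear //; exact: (proj2 hS).
  move=> _ [f _ <-]; split; first exact: antisymmetrize_antisymmetric.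
  by apply: sub_linspan; exists n, f.
apply/closureP => e e0; move/closureP: (Sy) => /(_ e e0)[z /sub[Az Sz] yz].
exists (summand F z) => //; move: yz.
have -> : nrm (summand F y - summand F z) = nrm (y - z) => //.
have -> : summand F y - summand F z = summand F (-1 *: z + y).
  by rewrite summand_linear // scaleN1r addrC.
have Ad : antisymmetric_power (-1 *: z + y) by apply: (proj2 hP).
apply/eqP; rewrite -[_ == _](@eqrXn2 _ 2) ?nrm_ge0 //; apply/eqP/complexI.
by rewrite -!dot_nrm dot_summand // scaleN1r addrC.
Qed.

End Wedge.

(** * Creation operators on the tensor product *)

Section Null.
Context {R : realType}.
Local Notation C := R[i].

Definition null_seq (V : normedModType C) (u : nat -> V) :=
  forall e : R, 0 < e -> \forall n \near \oo, nrm (u n) < e.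

Lemma null_seqD (V : normedModType C) (u v : nat -> V) :
  null_seq u -> null_seq v -> null_seq (fun n => u n + v n).
Proof.
move=> hu hv e e0; have e2 : 0 < e / 2 by rewrite divr_gt0.
apply: filterS2 (hu _ e2) (hv _ e2) => n h1 h2.
apply: le_lt_trans (nrmD _ _) _; lra.
Qed.

Lemma null_seqZ (V : normedModType C) (c : C) (u : nat -> V) :
  null_seq u -> null_seq (fun n => c *: u n).
Proof.
move=> hu e e0; have c0 : 0 < nrm c + 1 by rewrite ltr_wpDl ?nrm_ge0.
have eu : 0 < e / (nrm c + 1) by rewrite divr_gt0.
apply: filterS (hu _ eu) => n; rewrite ltr_pdivlMr // nrmZ mulrC => h.
by apply: le_lt_trans h; rewrite ler_wpM2r ?nrm_ge0 // lerDl.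
Qed.

Lemma null_seq0 (V : normedModType C) : null_seq (fun _ : nat => 0 : V).
Proof. by move=> e e0; apply: nearW => n; rewrite nrm0. Qed.

Lemma null_seq_sum (V : normedModType C) (I : Type) (r : seq I)
    (u : I -> nat -> V) : (forall i, null_seq (u i)) ->
  null_seq (fun n => \sum_(i <- r) u i n).
Proof.
move=> hu; elim: r => [|i r IH].
  by under eq_fun do rewrite big_nil; exact: null_seq0.
by under eq_fun do rewrite big_cons; exact: null_seqD.
Qed.

Lemma null_seq_ext (V : normedModType C) (u v : nat -> V) :
  (forall n, u n = v n) -> null_seq u -> null_seq v.
Proof. by move=> uv; rewrite (funext uv). Qed.

(** A uniform bound [M] lets convergence to 0 pass from a total set to the whole space; [s] admits
    antilinear maps, as needed for left arguments of [dot]. *)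
Lemma null_seq_total (V W : normedModType C) (s : C -> C) (f : nat -> V -> W)
    (M : R) (S : set V) :
  (forall n a x y, f n (a *: x + y) = s a *: f n x + f n y) ->
  (forall n x, nrm (f n x) <= M * nrm x) ->
  closure (linspan S) = setT ->
  (forall x, S x -> null_seq (f^~ x)) -> forall x, null_seq (f^~ x).
Proof.
move=> lf bf tS fS x.
have f0 n : f n 0 = 0.
  by apply: nrm0_eq0; apply/eqP; rewrite eq_le nrm_ge0 (le_trans (bf n 0)) ?nrm0 ?mulr0.
have hs : is_subspace [set x | null_seq (f^~ x)].
  split; first by apply: null_seq_ext (@null_seq0 _) => n; rewrite f0.
  move=> a y z hy hz; have := null_seqD (null_seqZ (s a) hy) hz.
  by apply: null_seq_ext => n; rewrite lf.
suff : closure (linspan S) `<=` [set x | null_seq (f^~ x)].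
  by apply; rewrite tS.
apply: closure_linspan_subset => //; apply/closed_nrmP => y cly e e0.
have M0 : 0 < `|M| + 1 by rewrite ltr_wpDl.
have [|z hz yz] := cly (e / 2 / (`|M| + 1)); first by rewrite !divr_gt0.
have e2 : 0 < e / 2 by rewrite divr_gt0.
apply: filterS (hz _ e2) => n hn.
have f1 u : s 1 *: f n u = f n u.
  by have := lf n 1 u 0; rewrite scale1r !addr0 f0 addr0.
have -> : y = 1 *: (y - z) + z by rewrite scale1r subrK.
rewrite lf f1; apply: le_lt_trans (nrmD _ _) _.
have : (`|M| + 1) * nrm (y - z) < e / 2 by rewrite mulrC -ltr_pdivlMr.
have := bf n (y - z); have := ler_wpM2r (nrm_ge0 (y - z)) (ler_norm M).
have := nrm_ge0 (y - z); lra.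
Qed.

End Null.

(** * Bounded operators determined by their values on generators *)

Section BoundedExtension.
Context {R : realType} {V W : hilbertType R}.
Local Notation C := R[i].

(** For a combination with coefficients c, the hypothesis sums to |sum c G1|^2 + |sum c G2|^2 = k^2
    |sum c G|^2, and the [G2] term is nonnegative. In particular linear relations among the [G i]
    persist among the [G1 i]. *)
Lemma linspan_bound (I : Type) (G : I -> V) (G1 G2 : I -> W) (k : R) : 0 <= k ->
  (forall i j, dot (G1 i) (G1 j) + dot (G2 i) (G2 j) = (k ^+ 2)%:C * dot (G i) (G j)) ->
  forall p, closure (linspan (range (fun i => (G i, G1 i)))) p -> nrm p.2 <= k * nrm p.1.
Proof.
move=> k0 hG.
have lin p : linspan (range (fun i => (G i, G1 i))) p -> nrm p.2 <= k * nrm p.1.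
  move=> [n [c [a [aP ->]]]].
  have /choice[t tP] : forall i, exists j, (G j, G1 j) = a i.
    by move=> i; have [j _ <-] := aP i; exists j.
  pose x := \sum_i c i *: G (t i); pose y := \sum_i c i *: G1 (t i).
  pose z := \sum_i c i *: G2 (t i).
  have -> : \sum_(i < n) c i *: a i = (x, y).
    have fE : forall q : V * W, q = (q.1, q.2) by case.
    rewrite [LHS]fE; congr pair.
      by rewrite (raddf_sum (@fst V W)); apply: eq_bigr => i _; rewrite -tP.
    by rewrite (raddf_sum (@snd V W)); apply: eq_bigr => i _; rewrite -tP.
  rewrite /= -ler_sqr ?nnegrE ?mulr_ge0 ?nrm_ge0 //.
  suff -> : (k * nrm x) ^+ 2 = nrm y ^+ 2 + nrm z ^+ 2 by rewrite lerDl exprn_ge0 ?nrm_ge0.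
  apply: complexI; rewrite exprMn rmorphM rmorphD /= -!dot_nrm.
  rewrite !dot_suml mulr_sumr -big_split; apply: eq_bigr => i _ /=.
  rewrite !dot_sumr mulr_sumr -big_split; apply: eq_bigr => j _ /=.
  by rewrite !dotZl !dotZr mulrCA [_%:C * (c j * _)]mulrCA -hG; ring.
move=> p /closureP clp; apply/ler_addgt0Pr => e e0.
pose q := e / (k + 1); have q0 : 0 < q by rewrite divr_gt0 // ltr_wpDl.
have qe : q * (k + 1) = e by rewrite divfK // gt_eqF // ltr_wpDl.
have [r /lin r12 /nrm_pair_lt[/= pr1 pr2]] := clp q q0.
have := nrm_triangle r.2 p.2 0; have := nrm_triangle p.1 r.1 0.
rewrite !subr0 (nrmBC r.1) => /(ler_wpM2l k0); have := ler_wpM2l k0 (ltW pr1); lra.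
Qed.

Lemma bounded_graph_total (L : set (V * W)) (k : R) : is_subspace L ->
  (forall p, closure L p -> nrm p.2 <= k * nrm p.1) ->
  closure [set p.1 | p in L] = setT -> forall x, exists y, closure L (x, y).
Proof.
move=> hL bL tL x.
have /closureP clx : closure [set p.1 | p in L] x by rewrite tL.
have /choice[u uP] : forall n, exists p : V * W, L p /\ nrm (x - p.1) < n.+1%:R^-1.
  move=> n; have [|_ [p Lp <-] xp] := clx n.+1%:R^-1; first by rewrite invr_gt0.
  by exists p.
have k1 : 0 < `|k| + 1 by rewrite ltr_wpDl.
have [|y uy] := @complete_nrm _ W (fun n => (u n).2).
  move=> e e0; have [|N hN] := @natSinv_lt _ (e / 2 / (`|k| + 1)).
    by rewrite !divr_gt0.
  exists N => m n Nm Nn.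
  have := bL _ (subset_closure (subspaceB hL (uP m).1 (uP n).1)) => /= h.
  have := nrm_triangle x (u m).1 (u n).1; rewrite (nrmBC _ x) => h1.
  have h2 : nrm ((u m).1 - (u n).1) < e / (`|k| + 1).
    have := hN _ Nm; have := hN _ Nn; have := (uP m).2; have := (uP n).2.
    rewrite !ltr_pdivlMr //; move: h1.
    move: (m.+1%:R^-1) (n.+1%:R^-1) => a b h1 h2 h3 h4 h5.
    have := ler_wpM2r (ltW k1) h1; nra.
  move: h2; rewrite ltr_pdivlMr // mulrC; apply: le_lt_trans.
  apply: le_trans h _; rewrite ler_wpM2r ?nrm_ge0 //.
  by rewrite (le_trans (ler_norm k)) // lerDl.
exists y; apply/closureP => e e0.
have [N1 _ h1] := uy _ e0; have [N2 h2] := natSinv_lt e0.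
pose n := maxn N1 N2; exists (u n); first exact: (uP n).1.
apply/nrm_pair_lt; split=> /=.
  by apply: lt_trans (uP n).2 _; apply: h2; rewrite leq_maxr.
by rewrite nrmBC; apply: h1 => /=; rewrite leq_maxl.
Qed.

End BoundedExtension.

Section FockTensor.
Context {R : realType} {X TT : hilbertType R} (F : fermion_fock X).
Context (HH : tensor_product F TT).
Local Notation C := R[i].

Lemma tensor_linear_l (t : TT) : linear (fun x : F => tensor HH x t).
Proof. by move=> a x y; rewrite linearPl. Qed.

Lemma nrm_tensor (x : F) (t : TT) : nrm (tensor HH x t) = nrm x * nrm t.
Proof.
apply/eqP; rewrite -(@eqrXn2 _ 2) ?mulr_ge0 ?nrm_ge0 //; apply/eqP/complexI.
by rewrite -dot_nrm dot_tensor !dot_nrm exprMn -rmorphM.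
Qed.

Lemma tensor_suml n (u : 'I_n -> F) (t : TT) :
  tensor HH (\sum_i u i) t = \sum_i tensor HH (u i) t.
Proof.
apply: (big_morph (fun x => tensor HH x t)) => [x y|]; first by rewrite linearDl.
by apply: nrm0_eq0; rewrite nrm_tensor nrm0 mul0r.
Qed.

Let I : Type := {n : nat & (('I_n -> X) * TT)%type}.

Definition basic (i : I) : HH := tensor HH (wedge F (tagged i).1) (tagged i).2.
Definition basic_cre (h : X) (i : I) : HH :=
  tensor HH (cre F h (tagged i).1) (tagged i).2.
Definition basic_ann (h : X) (i : I) : HH :=
  tensor HH (ann F h (tagged i).1) (tagged i).2.

Lemma basic_car h i j :
  dot (basic_cre h i) (basic_cre h j) + dot (basic_ann h i) (basic_ann h j) =
  (nrm h ^+ 2)%:C * dot (basic i) (basic j).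
Proof. by rewrite /basic_cre /basic_ann /basic !dot_tensor -mulrDl canonical_anticommutation dot_nrm mulrA. Qed.

Lemma pair_tensor_linear (t u : TT) :
  linear (fun p : F * F => (tensor HH p.1 t, tensor HH p.2 u)) /\
  forall p : F * F, nrm (tensor HH p.1 t, tensor HH p.2 u) <=
    (nrm t + nrm u) * nrm p.
Proof.
split=> [a p q|p]; first by rewrite !linearPl.
apply: le_trans (nrm_pair_le _) _; rewrite /= !nrm_tensor.
have := ler_wpM2l (nrm_ge0 t) (nrm_fst p).
have := ler_wpM2l (nrm_ge0 u) (nrm_snd p); lra.
Qed.

Lemma diag_tensor_linear (t u : TT) :
  linear (fun x : F => (tensor HH x t, tensor HH x u)) /\
  forall x : F, nrm (tensor HH x t, tensor HH x u) <= (nrm t + nrm u) * nrm x.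
Proof.
split=> [a p q|p]; first by rewrite !linearPl.
by apply: le_trans (nrm_pair_le _) _; rewrite /= !nrm_tensor; lra.
Qed.

Lemma basic_total : closure (linspan (range basic)) = setT.
Proof.
apply/seteqP; split=> // x _.
have : closure (linspan [set tensor HH p.1 p.2 | p in [set: F * TT]]) x.
  by rewrite (dense_closure (@tensor_total _ _ _ HH)).
have hL := closure_subspace (linspan_subspace (range basic)).
apply: closure_linspan_subset => //; first exact: closed_closure.
move=> _ [[y t] _ <-] /=.
have bf (x0 : F) : nrm (tensor HH x0 t) <= nrm t * nrm x0.
  by rewrite nrm_tensor mulrC.
have [hP cP] := bounded_preimage (tensor_linear_l t) bf hL (@closed_closure _ _).
have : closure (linspan [set v : F | exists n (f : 'I_n -> X), v = wedge F f]) y.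
  by rewrite wedge_total.
apply: (closure_linspan_subset hP cP) => _ [n [f ->]].
apply/subset_closure/sub_linspan.
by exists (Tagged (fun n => (('I_n -> X) * TT)%type) (f, t)).
Qed.

Definition creation_graph (h : X) : set (HH * HH) :=
  closure (linspan (range (fun i => (basic i, basic_cre h i)))).

Lemma creation_graph_subspace h : is_subspace (creation_graph h).
Proof. exact: closure_subspace (linspan_subspace _). Qed.

Lemma creation_graph_bound h p : creation_graph h p -> nrm p.2 <= nrm h * nrm p.1.
Proof. exact: linspan_bound (nrm_ge0 h) (basic_car h) _. Qed.

Lemma creation_graph_total h x : exists y, creation_graph h (x, y).
Proof.
apply: (bounded_graph_total (linspan_subspace _) (@creation_graph_bound h)).
apply/seteqP; split=> // z _.
have : closure (linspan (range basic)) z by rewrite basic_total.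
apply: closureS; apply: linspan_subset.
  split; first by exists 0 => //; exact: subspace0 (linspan_subspace _).
  move=> a _ _ [p Lp <-] [q Lq <-]; exists (a *: p + q) => //.
  exact: (proj2 (linspan_subspace _)).
move=> _ [i _ <-]; exists (basic i, basic_cre h i) => //.
by apply: sub_linspan; exists i.
Qed.

(** B*(h) (x) I as a function: totality of the graph provides a value, and the bound makes it
    unique. *)
Definition creationT (h : X) (x : HH) : HH := projT1 (cid (creation_graph_total h x)).

Lemma creationT_graph h x : creation_graph h (x, creationT h x).
Proof. by rewrite /creationT; case: cid. Qed.
Arguments creationT_graph : clear implicits.

Lemma creation_graph_fun h x y : creation_graph h (x, y) -> y = creationT h x.
Proof.
move=> hy; apply/eqP; rewrite -subr_eq0; apply/eqP/nrm0_eq0.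
have := creation_graph_bound (subspaceB (creation_graph_subspace h) hy (creationT_graph h x)).
by rewrite /= subrr nrm0 mulr0 => y0; apply/eqP; rewrite eq_le y0 nrm_ge0.
Qed.

Lemma creationT_linear h : linear (creationT h).
Proof.
move=> a x y; apply/esym/creation_graph_fun.
exact: (proj2 (creation_graph_subspace h)) a _ _ (creationT_graph h x) (creationT_graph h y).
Qed.

Lemma creationT_bound h x : nrm (creationT h x) <= nrm h * nrm x.
Proof. exact: creation_graph_bound (creationT_graph h x). Qed.

Lemma creationT_basic h i : creationT h (basic i) = basic_cre h i.
Proof.
by apply/esym/creation_graph_fun/subset_closure/sub_linspan; exists i.
Qed.

Lemma basic_ind (Q : set HH) : is_subspace Q -> closed Q ->
  (forall i, Q (basic i)) -> forall x, Q x.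
Proof.
move=> hQ cQ bQ x; suff : closure (linspan (range basic)) `<=` Q.
  by apply; rewrite basic_total.
by apply: closure_linspan_subset => // _ [i _ <-].
Qed.

Lemma op_tensor_creation h :
  op_tensor HH (creation F h) (op_id TT) = creation_graph h.
Proof.
apply/seteqP; split.
  apply: closure_linspan_subset.
  - exact: creation_graph_subspace.
  - exact: closed_closure.
  move=> _ [x [x' [y [y' [cx yy ->]]]]].
  move: yy; rewrite /op_id /= => {y'}->.
  have [lf bf] := pair_tensor_linear y y.
  have [hP cP] := bounded_preimage lf bf (creation_graph_subspace h) (@closed_closure _ _).
  apply: (closure_linspan_subset hP cP) cx => _ [n [g ->]].
  apply/subset_closure/sub_linspan.
  by exists (Tagged (fun n => (('I_n -> X) * TT)%type) (g, y)).
apply: closureS; apply: linspan_mono => _ [[n [f t]] _ <-].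
exists (wedge F f), (cre F h f), t, t; split => //.
by apply/subset_closure/sub_linspan; exists n, f.
Qed.

Lemma op_tensor_creationP h x y :
  op_tensor HH (creation F h) (op_id TT) (x, y) <-> y = creationT h x.
Proof.
rewrite op_tensor_creation; split; first exact: creation_graph_fun.
by move=> ->; exact: creationT_graph.
Qed.

Lemma creationT_linear_l a (h k : X) x :
  creationT (a *: h + k) x = a *: creationT h x + creationT k x.
Proof.
apply/eqP; rewrite -subr_eq0; apply/eqP.
pose f x := creationT (a *: h + k) x - (a *: creationT h x + creationT k x).
have [hf cf] : is_subspace [set x | f x = 0] /\ closed [set x | f x = 0].
  apply: (@bounded_kernel _ _ _ id f (nrm (a *: h + k) + (nrm a * nrm h + nrm k))).
    move=> b u v; rewrite /f !creationT_linear !scalerDr scalerN !scalerDr !scalerA.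
    by rewrite (mulrC a b) [X in _ - X]addrACA opprD addrACA.
  move=> u; apply: le_trans (nrmB _ _) _; rewrite !mulrDl.
  apply: lerD; first exact: creationT_bound.
  apply: le_trans (nrmD _ _) _; rewrite nrmZ; apply: lerD; last exact: creationT_bound.
  by rewrite -mulrA ler_wpM2l ?nrm_ge0 ?creationT_bound.
apply: (basic_ind hf cf) => i /=; rewrite /f !creationT_basic /basic_cre /cre.
rewrite wedge_fcons_linear scalerDr scalerA mulrC -scalerA linearDl linearZl_LR.
by rewrite subrr.
Qed.

End FockTensor.

Arguments tensor_suml {R X TT F} HH {n} u t.
Arguments basic {R X TT F} HH i.
Arguments basic_cre {R X TT F} HH h i.
Arguments basic_ann {R X TT F} HH h i.
Arguments basic_total {R X TT F} HH.
Arguments basic_car {R X TT F} HH h i j.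
Arguments pair_tensor_linear {R X TT F} HH t u.
Arguments diag_tensor_linear {R X TT F} HH t u.
Arguments creationT {R X TT F} HH h x.
Arguments creationT_linear {R X TT F} HH h.
Arguments creationT_bound {R X TT F} HH h x.
Arguments creationT_basic {R X TT F} HH h i.

(** * Weak commutators of the free Hamiltonian with creation operators *)

Section Commutators.
Context {R : realType}.
Local Notation C := R[i].

Lemma scalerCE (c x : C) : c *: x = c * x.
Proof. by []. Qed.

(** With [P] inside the graph of a symmetric A, this is AB = BA + D in weak form. The closure is
    taken first in [q], then in [p]; boundedness of [B] and [D] makes each defect continuous on
    pairs. *)
Lemma commutator_closure (V : hilbertType R) (P : set (V * V)) (B D : V -> V) (b d : R) :
  linear B -> (forall x, nrm (B x) <= b * nrm x) ->
  linear D -> (forall x, nrm (D x) <= d * nrm x) ->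
  (forall p q, P p -> P q -> dot p.2 (B q.1) = dot p.1 (B q.2 + D q.1)) ->
  forall p q, closure (linspan P) p -> closure (linspan P) q ->
    dot p.2 (B q.1) = dot p.1 (B q.2 + D q.1).
Proof.
move=> lB bB lD bD PP.
have left p q : P p -> closure (linspan P) q -> dot p.2 (B q.1) = dot p.1 (B q.2 + D q.1).
  move=> Pp cq.
  pose f (r : V * V) := dot p.2 (B r.1) - dot p.1 (B r.2 + D r.1).
  have [hf cf] : is_subspace [set r | f r = 0] /\ closed [set r | f r = 0].
    apply: (@bounded_kernel _ _ _ id f (nrm p.2 * `|b| + nrm p.1 * (`|b| + `|d|))).
      by move=> a r s; rewrite /f /= !lB lD !dotDr !dotZr /= !scalerCE; ring.
    move=> r; apply: le_trans (nrmB _ _) _; rewrite mulrDl -!mulrA.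
    have nb x : nrm (B x) <= `|b| * nrm x.
      by apply: le_trans (bB x) _; rewrite ler_wpM2r ?nrm_ge0 // ler_norm.
    have nd x : nrm (D x) <= `|d| * nrm x.
      by apply: le_trans (bD x) _; rewrite ler_wpM2r ?nrm_ge0 // ler_norm.
    apply: lerD; (apply: le_trans (cauchy_schwarz _ _) _; rewrite ler_wpM2l ?nrm_ge0 //).
      by apply: le_trans (nb _) _; rewrite ler_wpM2l ?nrm_fst.
    apply: le_trans (nrmD _ _) _; rewrite mulrDl; apply: lerD.
      by apply: le_trans (nb _) _; rewrite ler_wpM2l ?nrm_snd.
    by apply: le_trans (nd _) _; rewrite ler_wpM2l ?nrm_fst.
  apply/eqP; rewrite -subr_eq0; apply/eqP.
  apply: (closure_linspan_subset hf cf) cq => r Pr.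
  by rewrite /f /= (PP _ _ Pp Pr) subrr.
move=> p q cp cq.
pose g (r : V * V) := dot r.2 (B q.1) - dot r.1 (B q.2 + D q.1).
have [hg cg] : is_subspace [set r | g r = 0] /\ closed [set r | g r = 0].
  apply: (@bounded_kernel _ _ _ (@conjc R) g (nrm (B q.1) + nrm (B q.2 + D q.1))).
    by move=> a r s; rewrite /g /= !dotDl !dotZl !scalerCE; ring.
  move=> r; apply: le_trans (nrmB _ _) _; rewrite mulrDl.
  apply: lerD; (apply: le_trans (cauchy_schwarz _ _) _; rewrite mulrC ler_wpM2l ?nrm_ge0 //).
    exact: nrm_snd.
  exact: nrm_fst.
apply/eqP; rewrite -subr_eq0; apply/eqP.
apply: (closure_linspan_subset hg cg) cp => r Pr.
by rewrite /g /= (left _ _ Pr cq) subrr.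
Qed.

Context {X TT : hilbertType R} (F : fermion_fock X) (HH : tensor_product F TT).

Lemma op_tensor_second_quantization (K : set (X * X)) :
  op_tensor HH (second_quantization F K) (op_id TT) `<=`
  closure (linspan [set p : HH * HH | exists n (f g : 'I_n -> X) t,
    (forall i, K (f i, g i)) /\
    p = (tensor HH (wedge F f) t, tensor HH (dgamma F f g) t)]).
Proof.
apply: closure_linspan_subset.
- exact: closure_subspace (linspan_subspace _).
- exact: closed_closure.
move=> _ [x [x' [y [y' [cx yy ->]]]]]; move: yy; rewrite /op_id /= => {y'}->.
have [lf bf] := pair_tensor_linear HH y y.
set D := closure _.
have [hP cP] := bounded_preimage lf bf (closure_subspace (linspan_subspace _) : is_subspace D)
  (@closed_closure _ _).
apply: (closure_linspan_subset hP cP) cx => _ [n [f [g [Kfg ->]]]].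
by apply/subset_closure/sub_linspan; exists n, f, g, y.
Qed.

Lemma op_tensor_right (T : set (TT * TT)) :
  op_tensor HH (op_id F) T `<=`
  closure (linspan [set p : HH * HH | exists n (f : 'I_n -> X) t t',
    T (t, t') /\ p = (tensor HH (wedge F f) t, tensor HH (wedge F f) t')]).
Proof.
apply: closure_linspan_subset.
- exact: closure_subspace (linspan_subspace _).
- exact: closed_closure.
move=> _ [x [x' [y [y' [xx Ty ->]]]]]; move: xx; rewrite /op_id /= => {x'}->.
have [lf bf] := diag_tensor_linear HH y y'.
set D := closure _.
have [hP cP] := bounded_preimage lf bf (closure_subspace (linspan_subspace _) : is_subspace D)
  (@closed_closure _ _).
have : closure (linspan [set v : F | exists n (f : 'I_n -> X), v = wedge F f]) x.
  by rewrite wedge_total.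
apply: (closure_linspan_subset hP cP) => _ [n [f ->]].
by apply/subset_closure/sub_linspan; exists n, f, y, y'.
Qed.

Lemma creationT_wedge h n (f : 'I_n -> X) t :
  creationT HH h (tensor HH (wedge F f) t) = tensor HH (cre F h f) t.
Proof. exact: (creationT_basic HH h (Tagged (fun n => (('I_n -> X) * TT)%type) (f, t))). Qed.

Lemma creationT_sum h n (u : 'I_n -> HH) :
  creationT HH h (\sum_i u i) = \sum_i creationT HH h (u i).
Proof.
have l0 : creationT HH h 0 = 0.
  by apply: nrm0_eq0; apply/eqP; rewrite eq_le nrm_ge0 (le_trans (creationT_bound _ _ _)) ?nrm0 ?mulr0.
apply: (big_morph (creationT HH h)) => // x y.
by rewrite -[x]scale1r creationT_linear !scale1r.
Qed.

(** The commutator of dGamma(K) with B*(h) is B*(K h), here k: on wedges this combines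
    [dgamma_fcons] with the symmetry of [dgamma]. *)
Lemma creationT_dgamma (K : set (X * X)) h k :
  (forall x y u v, K (x, y) -> K (u, v) -> dot v x = dot u y) -> K (h, k) ->
  forall p q, op_tensor HH (second_quantization F K) (op_id TT) p ->
    op_tensor HH (second_quantization F K) (op_id TT) q ->
    dot p.2 (creationT HH h q.1) =
    dot p.1 (creationT HH h q.2 + creationT HH k q.1).
Proof.
move=> Ksym Khk p q /op_tensor_second_quantization cp /op_tensor_second_quantization cq.
apply: (commutator_closure (creationT_linear HH h) (creationT_bound HH h)
  (creationT_linear HH k) (creationT_bound HH k) _ cp cq).
move=> {p q cp cq} _ _ [n [f [f' [t [Kf ->]]]]] [m [g [g' [s [Kg ->]]]]] /=.
rewrite !creationT_wedge [dgamma F g g']/dgamma.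
rewrite (tensor_suml HH (fun j => wedge F [eta g with j |-> g' j])) creationT_sum.
under eq_bigr do rewrite creationT_wedge.
rewrite -tensor_suml -linearDl !dot_tensor; congr (_ * _).
rewrite /cre -scaler_sumr -scalerDr !dotZr; congr (_ * _).
rewrite addrC -dgamma_fcons; apply: dgamma_sym => i j.
case: (unliftP ord0 j) => [j'|] ->; rewrite ?fconsS ?fcons0.
  exact: Ksym (Kg _) (Kf _).
exact: Ksym Khk (Kf _).
Qed.

Lemma creationT_right (T : set (TT * TT)) h :
  (forall x y u v, T (x, y) -> T (u, v) -> dot v x = dot u y) ->
  forall p q, op_tensor HH (op_id F) T p -> op_tensor HH (op_id F) T q ->
    dot p.2 (creationT HH h q.1) = dot p.1 (creationT HH h q.2).
Proof.
move=> Tsym p q /op_tensor_right cp /op_tensor_right cq.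
have l0 : linear (fun _ : HH => 0 : HH) by move=> a x y; rewrite scaler0 addr0.
have b0 (x : HH) : nrm (0 : HH) <= 0 * nrm x by rewrite nrm0 mul0r.
have := commutator_closure (creationT_linear HH h) (creationT_bound HH h) l0 b0.
move=> /(_ _ _ _ _ cp cq); rewrite addr0; apply.
move=> {p q cp cq} _ _ [n [f [t [t' [Tt ->]]]]] [m [g [s [s' [Ts ->]]]]] /=.
by rewrite addr0 !creationT_wedge !dot_tensor (Tsym _ _ _ _ Ts Tt).
Qed.

(** * Creation operators along a weakly null sequence of unit vectors *)

Section WeakLimit.
Variable h : nat -> X.
Hypothesis h1 : forall n, nrm (h n) = 1.
Hypothesis hw : forall k, null_seq (fun n => dot k (h n)).

Lemma dot_cre_null n m (f : 'I_n -> X) (g : 'I_m -> X) :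
  null_seq (fun k => dot (wedge F f) (cre F (h k) g)).
Proof.
have [nm|/eqP nm] := eqVneq n m.+1; last first.
  apply: null_seq_ext (@null_seq0 _ _) => k.
  by rewrite /cre dotZr dot_wedge_neq // mulr0.
subst n; have [c cE] := dot_wedge_fcons F f g.
have := @null_seqZ _ _ (Num.sqrt (m.+1%:R : R))%:C _
  (@null_seq_sum _ _ _ (index_enum _) _ (fun i => null_seqZ (c i) (hw (f i)))).
by apply: null_seq_ext => k; rewrite /cre dotZr cE.
Qed.

Lemma creationT_weak0 v x : null_seq (fun n => dot v (creationT HH (h n) x)).
Proof.
apply: (@null_seq_total _ _ _ id (fun n x => dot v (creationT HH (h n) x)) (nrm v)
  _ _ _ (basic_total HH)).
- by move=> n a y z; rewrite creationT_linear dotDr dotZr.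
- move=> n y; apply: le_trans (cauchy_schwarz _ _) _.
  by rewrite ler_wpM2l ?nrm_ge0 // -[nrm y]mul1r -(h1 n) creationT_bound.
move=> _ [j _ <-].
apply: (@null_seq_total _ _ _ (@conjc R)
  (fun n v => dot v (creationT HH (h n) (basic HH j))) (nrm (basic HH j))
  _ _ _ (basic_total HH)).
- by move=> n a y z; rewrite dotDl dotZl.
- move=> n y; apply: le_trans (cauchy_schwarz _ _) _; rewrite mulrC.
  by rewrite ler_wpM2r ?nrm_ge0 // -[leRHS]mul1r -(h1 n) creationT_bound.
move=> _ [i _ <-].
have := null_seqZ (dot (tagged i).2 (tagged j).2) (@dot_cre_null _ _ (tagged i).1 (tagged j).1).
apply: null_seq_ext => n; rewrite creationT_basic /basic /basic_cre dot_tensor mulrC.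
by [].
Qed.

(** On generators the anticommutation relation identifies the difference with minus the inner
    product of two annihilation terms, both of which tend to 0. *)
Lemma creationT_dot_limit v x :
  null_seq (fun n => dot (creationT HH (h n) v) (creationT HH (h n) x) - dot v x).
Proof.
have nc n y : nrm (creationT HH (h n) y) <= nrm y.
  by rewrite -[leRHS]mul1r -(h1 n) creationT_bound.
have bd n y z : nrm (dot (creationT HH (h n) y) (creationT HH (h n) z) - dot y z) <=
    2 * nrm y * nrm z.
  apply: le_trans (nrmB _ _) _.
  have := cauchy_schwarz y z.
  have := cauchy_schwarz (creationT HH (h n) y) (creationT HH (h n) z).
  have := ler_pM (nrm_ge0 _) (nrm_ge0 _) (nc n y) (nc n z); lra.
apply: (@null_seq_total _ _ _ id (fun n x =>
  dot (creationT HH (h n) v) (creationT HH (h n) x) - dot v x) (2 * nrm v)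
  _ _ _ (basic_total HH)).
- by move=> n a y z; rewrite creationT_linear !dotDr !dotZr; rewrite /= ?scalerCE; ring.
- by move=> n y; exact: bd.
move=> _ [j _ <-].
apply: (@null_seq_total _ _ _ (@conjc R) (fun n v =>
  dot (creationT HH (h n) v) (creationT HH (h n) (basic HH j)) - dot v (basic HH j))
  (2 * nrm (basic HH j)) _ _ _ (basic_total HH)).
- by move=> n a y z; rewrite creationT_linear !dotDl !dotZl; rewrite /= ?scalerCE; ring.
- by move=> n y; apply: le_trans (bd n _ _) _; rewrite mulrAC.
move=> _ [i _ <-].
have an k : null_seq (fun n => basic_ann HH (h n) k).
  move=> e e0; have t0 : 0 < nrm (tagged k).2 + 1 by rewrite ltr_wpDl ?nrm_ge0.
  have et : 0 < e / (nrm (tagged k).2 + 1) by rewrite divr_gt0.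
  have := nrm_ann_null F (tagged k).1 hw et.
  apply: filterS => n; rewrite ltr_pdivlMr // /basic_ann nrm_tensor.
  by apply: le_lt_trans; rewrite ler_wpM2l ?nrm_ge0 // lerDl.
move=> e e0; have m0 : 0 < Num.min 1 e by rewrite lt_min ltr01.
apply: filterS2 (an i _ m0) (an j _ m0) => n hi hj.
rewrite !creationT_basic.
have := basic_car HH (h n) i j; rewrite h1 expr1n mul1r => <-.
rewrite opprD addrA subrr add0r nrmN.
apply: le_lt_trans (cauchy_schwarz _ _) _.
have me : Num.min 1 e <= e by rewrite ge_min lexx orbT.
have m1 : Num.min 1 e <= 1 by rewrite ge_min lexx.
apply: le_lt_trans (lt_le_trans hi me).
by rewrite ler_piMr ?nrm_ge0 // ltW // (lt_le_trans hj).
Qed.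

End WeakLimit.

End Commutators.

Unset Implicit Arguments.

(** * The essential spectrum of H *)

Theorem theorem1p1 (R : realType) (KK TT : hilbertType R)
    (TT_nontrivial : exists t : TT, t != 0)
    (F : fermion_fock KK) (HH : tensor_product F TT)
    (K : set (KK * KK)) (T : set (TT * TT)) (HI : set (HH * HH))
    (K_self_adjoint : self_adjoint K)
    (K_nonnegative : nonnegative_op K)
    (K_kernel : kernel K = [set 0])
    (T_self_adjoint : self_adjoint T)
    (T_bounded_below : bounded_below T)
    (HI_symmetric : symmetric_op HI) :
  let H0 : set (HH * HH) :=
    op_add (op_tensor HH (second_quantization F K) (op_id TT))
           (op_tensor HH (op_id F) T) in
  let H : set (HH * HH) := op_add H0 HI in
  let B (h : KK) : set (HH * HH) :=
    op_tensor HH (annihilation F h) (op_id TT) in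
  let Bstar (h : KK) : set (HH * HH) :=
    op_tensor HH (creation F h) (op_id TT) in
  let E0 : R := inf (spectrum H) in
  self_adjoint H -> bounded_below H ->
  (forall h : KK, dom K h ->
     weak_commutator_exists HI (B h) (dom H) /\
     weak_commutator_exists HI (Bstar h) (dom H)) ->
  (forall h : nat -> KK,
     (forall n, dom K (h n)) -> (forall n, `|h n| = 1) ->
     (forall k : KK, dot k (h n) @[n --> \oo] --> (0 : R[i])) ->
     forall Psi : HH, dom H Psi ->
       (forall v : nat -> HH,
          (forall n, weak_commutator HI (B (h n)) (dom H) (Psi, v n)) ->
          `|v n| @[n --> \oo] --> (0 : R[i])) /\
       (forall v : nat -> HH,
          (forall n, weak_commutator HI (Bstar (h n)) (dom H) (Psi, v n)) ->
          `|v n| @[n --> \oo] --> (0 : R[i]))) ->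
  closure [set E0 + l | l in ess_spectrum K `\ 0] `<=` ess_spectrum H.
Proof.
move=> H0 H B Bstar E0 Hsa Hbb wc wlim E clE.
apply: (ess_spectrum_of_approximation Hsa) => e e0 s.
(* The closure is absorbed into the error: [l] may depend on [e], and E0 + l need only be within e /
   8 of [E]. *)
have e8 : 0 < e / 8 by rewrite divr_gt0.
have [_ [[l [lK _] <-] lE]] := clE _ (nbhsx_ballx E _ e8).
have [h [g [Khg h1 horth gh]]] := weyl_sequence K_self_adjoint lK.
have hw k : null_seq (fun n => dot k (h n)).
  by move=> r r0; exact: bessel_weak0 h1 horth k r r0.
have [m sm mE] : exists2 m, spectrum H m & E0 <= m < E0 + e / 8.
  have lbH := spectrum_lbound Hsa Hbb.
  have neH : spectrum H !=set0.
    apply: (spectrum_nonempty Hsa); have [t t0] := TT_nontrivial.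
    (* The empty family gives the vacuum, of norm 1; its product with [t] shows that the space is
       nonzero, so that the spectrum is not empty and its infimum is approached. *)
    have f0 (i : 'I_0) : KK by case: i.
    exists (tensor HH (wedge F f0) t); apply/eqP => x0.
    have : dot (tensor HH (wedge F f0) t) (tensor HH (wedge F f0) t) = 0.
      by rewrite x0 dot0r.
    rewrite dot_tensor dot_wedge det_mx00 fact0 invr1 !mul1r => /dot_eq0 /eqP.
    by rewrite (negbTE t0).
  have [m sm mE] := inf_adherent e8 (conj neH lbH).
  by exists m => //; rewrite mE andbT; apply: ge_inf.
have [Psi [HPsi [HP P1 mP]]] := (spectrumP Hsa m).1 sm _ e8.
have dP : dom H Psi by exists HPsi.
have Khn n : dom K (h n) by exists (g n).
have /choice[v vP] : forall n, exists v, exists2 Z,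
    is_weak_commutator HI (Bstar (h n)) (dom H) Z & Z (Psi, v).
  move=> n; have [_ [Z wZ]] := wc _ (Khn n).
  have [_ [_ _ sub] _] := wZ; have [[[[[w Zw] _] _] _] _] := sub _ dP.
  by exists w, Z.
have v0 : null_seq v.
  have hn1 n : `|h n| = 1 by rewrite nrmE h1.
  have hn0 k : dot k (h n) @[n --> \oo] --> (0 : R[i]).
    by apply/cvg_nrmP => r r0; apply: filterS (hw k r r0) => n; rewrite subr0.
  have [_ vl] := wlim h Khn hn1 hn0 Psi dP.
  have /cvg_nrmP vl' : `|v n| @[n --> \oo] --> (0 : R[i]).
    by apply: vl => n; split => //; exact: vP.
  move=> r r0; apply: filterS (vl' r r0) => n.
  by rewrite subr0 nrmE nrm_real ger0_norm ?nrm_ge0.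
pose x n := creationT HH (h n) Psi.
pose y n := creationT HH (h n) HPsi + creationT HH (g n) Psi + v n.
(* The domain question: it suffices to show <H u, x n> = <u, y n> for all u in dom H, where the weak
   commutator applies to the pair u, Psi. *)
have Hxy n : H (x n, y n).
  apply: (self_adjoint_max Hsa) => u w [w0 [w1 [[a [b [/= ua ub w0E]]] uw1 wE]]].
  have [p0 [p1 [[a' [b' [/= Pa Pb p0E]]] Pp1 PE]]] := HP.
  move: (wE) PE; rewrite /= w0E p0E => wE' PE.
  have [Z [_ [_ _ sub] comm] Zv] := vP n.
  have H0u : H0 (u, w0) by exists a, b; split; [exact: ua|exact: ub|exact: w0E].
  have du : dom H u by exists w, w0, w1; split; [exact: H0u|exact: uw1|exact: wE].
  have [_ [bf ubf]] := sub _ du.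
  have BP : Bstar (h n) (Psi, x n) by apply/op_tensor_creationP.
  have := comm u Psi w1 bf p1 (x n) (v n) du dP (proj2 HI_symmetric _ uw1) ubf Pp1 BP Zv.
  (* [bf] is the adjoint of B*(h n) (x) I applied to [u]; moving the operator back onto HI Psi
     avoids any formula for annihilation. *)
  have -> : dot bf p1 = dot u (creationT HH (h n) p1).
    rewrite [LHS]dotC [RHS]dotC; congr (_^*%C).
    have Bp : Bstar (h n) (p1, creationT HH (h n) p1) by apply/op_tensor_creationP.
    exact: esym (ubf _ _ Bp).
  move=> /eqP; rewrite subr_eq => /eqP c1.
  have c2 := creationT_dgamma (self_adjoint_sym K_self_adjoint) (Khg n) ua Pa.
  have c3 := creationT_right (h n) (self_adjoint_sym T_self_adjoint) ub Pb.
  rewrite wE' !dotDl c1 /x [dot a _]c2 [dot b _]c3 /y PE /=.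
  have crD z z' : creationT HH (h n) (z + z') = creationT HH (h n) z + creationT HH (h n) z'.
    by rewrite -[z]scale1r creationT_linear !scale1r.
  rewrite !crD !dotDr; ring.
have sf : \forall n \near \oo, forall i : 'I_(size s), nrm (dot s`_i (x n)) < e.
  by apply: filter_forall => i; exact: creationT_weak0.
have x1 : \forall n \near \oo, 1 / 2 <= nrm (x n).
  have q0 : 0 < 3 / 4 :> R by rewrite divr_gt0.
  apply: filterS (@creationT_dot_limit _ _ _ _ HH h h1 hw Psi Psi _ q0) => n.
  rewrite !dot_nrm -rmorphB nrm_real P1 expr1n ltr_norml => /andP[xn _].
  rewrite -ler_sqr ?nnegrE ?nrm_ge0 ?divr_ge0 //; move: xn; rewrite -/(x n); lra.
have [N0 N0P] := natSinv_lt e8.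
have inv : \forall n \near \oo, n.+1%:R^-1 < e / 8 by exists N0.
have [N _ NP] : \forall n \near \oo, [/\ forall i : 'I_(size s), nrm (dot s`_i (x n)) < e,
    1 / 2 <= nrm (x n), nrm (v n) < e / 8 & n.+1%:R^-1 < e / 8].
  near=> n; split; near: n => //; exact: v0.
have [sN xN vN iN] := NP N (leqnn N).
exists (x N), (y N); split => //; last first.
  by move=> f /(nthP 0)[i is_ <-]; apply: ltW; exact: (sN (Ordinal is_)).
have -> : y N - E%:C *: x N = creationT HH (h N) (HPsi - m%:C *: Psi) +
    creationT HH (g N - l%:C *: h N) Psi + v N + (m + l - E)%:C *: x N.
  rewrite /y /x.
  have -> : HPsi - m%:C *: Psi = (- m%:C) *: Psi + HPsi by rewrite scaleNr addrC.
  have -> : g N - l%:C *: h N = (- l%:C) *: h N + g N by rewrite scaleNr addrC.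
  rewrite creationT_linear creationT_linear_l rmorphB rmorphD.
  rewrite !scaleNr scalerBl scalerDl [- _ + _ + (_ + _)]addrACA -opprD.
  move: (m%:C *: _ + _) (_ + creationT _ (g N) _) (E%:C *: _) => p q r.
  by rewrite [RHS]addrA; congr (_ - r); rewrite [RHS]addrC -!addrA addNKr.
have xN1 : nrm (x N) <= 1.
  by have := creationT_bound HH (h N) Psi; rewrite h1 P1 mulr1.
(* One e / 8 from m near E0, one from E0 + l near [E]. The other three terms contribute e / 8 each,
   5 e / 8 altogether. *)
have mlE : `|m + l - E| <= e / 4.
  move: lE mE; rewrite /ball /= ltr_norml => /andP[h2 h3] /andP[h4 h5].
  by rewrite ler_norml; apply/andP; split; lra.
apply: le_trans (nrmD _ _) _; rewrite nrmZ nrm_real.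
have := ler_pM (normr_ge0 _) (nrm_ge0 _) mlE xN1.
have := creationT_bound HH (h N) (HPsi - m%:C *: Psi).
have := creationT_bound HH (g N - l%:C *: h N) Psi.
have := nrmD (creationT HH (h N) (HPsi - m%:C *: Psi) +
  creationT HH (g N - l%:C *: h N) Psi) (v N).
have := nrmD (creationT HH (h N) (HPsi - m%:C *: Psi))
  (creationT HH (g N - l%:C *: h N) Psi).
rewrite h1 P1 mul1r !mulr1; have := gh N; move: iN vN mP.
by move: (N.+1%:R^-1) => i; lra.
Unshelve. all: by end_near.
Qed.
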